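(* Let $G$ be a right-angled Artin group whose defining graph $\Gamma$ is connected, triangle-free, and has no vertices of valence $<2$. Let $\mathcal{P}$ be the collection of maximal standard abelian subgroups of $G$. Then the coset intersection complex $\mathcal{K}(G,\mathcal{P})$ is (Gromov) hyperbolic and quasi-isometric to a tree.
   Context: The defining graph $\Gamma$ is a finite simplicial graph; the right-angled Artin group $G$ has the vertices of $\Gamma$ as standard generators, with two generators commuting as a defining relation exactly when they are adjacent in $\Gamma$. A standard subgroup is a subgroup generated by a set of standard generators. Under the stated hypotheses the maximal standard abelian subgroups are exactly the subgroups $\langle a,b\rangle\cong\mathbb{Z}^2$ with $\{a,b\}$ an edge of $\Gamma$. $G/\mathcal{P}$ denotes the set of all left cosets $gP$ with $g\in G$, $P\in\mathcal{P}$. The coset intersection complex $\mathcal{K}(G,\mathcal{P})$ is the simplicial complex with vertex set $G/\mathcal{P}$ in which a finite set $\{g_1P_1,\dots,g_kP_k\}\subset G/\mathcal{P}$ spans a simplex if and only if $\bigcap_{i=1}^k g_iP_ig_i^{-1}$ is infinite. It carries the length metric of a piecewise Euclidean complex all of whose simplices are regular Euclidean simplices with unit edge lengths (the distance between points in different components is $\infty$). *)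

(* Defs.v *)
From HB Require Import structures.
From mathcomp Require Import all_boot all_order all_algebra.
From mathcomp Require Import finmap generic_quotient.
From mathcomp Require Import boolp classical_sets functions cardinality.
From mathcomp Require Import reals constructive_ereal ereal.

Set Implicit Arguments.
Unset Strict Implicit.
Unset Printing Implicit Defensive.

Import Order.TTheory GRing.Theory Num.Theory.

Local Open Scope classical_set_scope.
Local Open Scope ring_scope.

(** * Graphs *)

Definition triangle_free (V : Type) (e : rel V) : Prop :=
  forall u v w, e u v -> e v w -> ~~ e u w.

(** A connected graph is nonempty by convention. *)
Definition connected_graph (V : eqType) (e : rel V) : Prop :=
  inhabited V /\ forall u v, exists2 p, path e u p & last u p = v.

Definition valence (V : finType) (e : rel V) (v : V) : nat :=
  #|[pred w | e v w]|.

(** [ucycle e [:: u; v]] holds as soon as [u] and [v] are adjacent, so the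
    circuits of a simplicial graph are the [ucycle]s of length at least 3. *)
Definition is_tree (V : eqType) (e : rel V) : Prop :=
  [/\ symmetric e, irreflexive e, connected_graph e
    & forall c, ucycle e c -> (size c <= 2)%N].

(** * Right-angled Artin groups *)

(** The letter [(v, false)] stands for the generator [v], and [(v, true)] for
    its inverse. *)
Notation word V := (seq (V * bool)).

(** The congruence on words defining the group presented by
    < V | u v = v u whenever e u v >. *)
Inductive raag_eq (V : Type) (e : rel V) : word V -> word V -> Prop :=
| RaagRefl w : raag_eq e w w
| RaagSym w1 w2 : raag_eq e w1 w2 -> raag_eq e w2 w1
| RaagTrans w1 w2 w3 : raag_eq e w1 w2 -> raag_eq e w2 w3 -> raag_eq e w1 w3
| RaagCancel w1 w2 v b :
    raag_eq e (w1 ++ [:: (v, b); (v, ~~ b)] ++ w2) (w1 ++ w2)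
| RaagComm w1 w2 u v : e u v ->
    raag_eq e (w1 ++ [:: (u, false); (v, false)] ++ w2)
              (w1 ++ [:: (v, false); (u, false)] ++ w2).

Lemma raag_eq_ctx (V : Type) (e : rel V) l r w1 w2 :
  raag_eq e w1 w2 -> raag_eq e (l ++ w1 ++ r) (l ++ w2 ++ r).
Proof.
elim => {w1 w2} [w|w1 w2 _|w1 w2 w3 _ h1 _ h2|w1 w2 v b|w1 w2 u v uv].
- exact: RaagRefl.
- exact: RaagSym.
- exact: RaagTrans h1 h2.
- by rewrite -!catA !(catA l w1); apply: RaagCancel.
- by rewrite -!catA !(catA l w1); apply: RaagComm.
Qed.

Lemma raag_eq_cat (V : Type) (e : rel V) u1 u2 w1 w2 :
  raag_eq e u1 u2 -> raag_eq e w1 w2 -> raag_eq e (u1 ++ w1) (u2 ++ w2).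
Proof.
move=> hu hw; apply: (RaagTrans (w2 := u2 ++ w1)).
  exact: (raag_eq_ctx [::] w1 hu).
by have := raag_eq_ctx u2 [::] hw; rewrite !cats0.
Qed.

Definition inv_word (V : Type) (w : word V) : word V :=
  rev [seq (x.1, ~~ x.2) | x <- w].

Lemma inv_word_cat (V : Type) (u w : word V) :
  inv_word (u ++ w) = inv_word w ++ inv_word u.
Proof. by rewrite /inv_word map_cat rev_cat. Qed.

Lemma inv_wordK (V : Type) : involutive (@inv_word V).
Proof.
move=> w; rewrite /inv_word map_rev revK -map_comp -[RHS]map_id.
by apply: eq_map => -[v b] /=; rewrite negbK.
Qed.

Lemma raag_eq_mulV (V : Type) (e : rel V) w : raag_eq e (w ++ inv_word w) [::].
Proof.
elim: w => [|[v b] w ih]; first exact: RaagRefl.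
rewrite -[_ :: w]cat1s inv_word_cat -catA (catA w).
apply: RaagTrans (raag_eq_ctx [:: (v, b)] (inv_word [:: (v, b)]) ih) _.
exact: (RaagCancel e [::] [::] v b).
Qed.

Lemma raag_eq_Vmul (V : Type) (e : rel V) w : raag_eq e (inv_word w ++ w) [::].
Proof. by rewrite -{2}(inv_wordK w); apply: raag_eq_mulV. Qed.

Lemma raag_eq_inv (V : Type) (e : rel V) w1 w2 :
  raag_eq e w1 w2 -> raag_eq e (inv_word w1) (inv_word w2).
Proof.
move=> h; apply: (RaagTrans (w2 := inv_word w1 ++ w2 ++ inv_word w2)).
  apply: RaagSym; have := raag_eq_ctx (inv_word w1) [::] (raag_eq_mulV e w2).
  by rewrite !cats0.
rewrite catA; have hc := raag_eq_cat (RaagRefl e (inv_word w1)) (RaagSym h).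
have := raag_eq_ctx [::] (inv_word w2) (RaagTrans hc (raag_eq_Vmul e w1)).
by rewrite !cat0s.
Qed.

Definition raag_rel (V : finType) (e : rel V) : rel (word V) :=
  fun w1 w2 => `[< raag_eq e w1 w2 >].

Lemma raag_rel_refl (V : finType) (e : rel V) : reflexive (raag_rel e).
Proof. by move=> w; apply/asboolP; apply: RaagRefl. Qed.

Lemma raag_rel_sym (V : finType) (e : rel V) : symmetric (raag_rel e).
Proof. by move=> u w; apply/asboolP/asboolP; apply: RaagSym. Qed.

Lemma raag_rel_trans (V : finType) (e : rel V) : transitive (raag_rel e).
Proof.
by move=> v u w /asboolP uv /asboolP vw; apply/asboolP; apply: RaagTrans vw.
Qed.

Canonical raag_equiv (V : finType) (e : rel V) :=
  EquivRel (raag_rel e) (@raag_rel_refl V e) (@raag_rel_sym V e)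
    (@raag_rel_trans V e).

(** The right-angled Artin group with defining graph [e]. *)
Definition raag (V : finType) (e : rel V) : Type := {eq_quot raag_equiv e}%qT.

HB.instance Definition _ (V : finType) (e : rel V) := Choice.on (raag e).
HB.instance Definition _ (V : finType) (e : rel V) :=
  EqQuotient.on (raag e).

Definition raag_of_word (V : finType) (e : rel V) (w : word V) : raag e :=
  (\pi_(raag e) w)%qT.

Lemma raag_of_wordP (V : finType) (e : rel V) w1 w2 :
  raag_of_word e w1 = raag_of_word e w2 <-> raag_eq e w1 w2.
Proof. by split=> [/eqmodP/asboolP //|h]; apply/eqmodP/asboolP. Qed.

Lemma raag_of_wordK (V : finType) (e : rel V) (x : raag e) :
  raag_of_word e (repr x) = x.
Proof. exact: reprK. Qed.

Definition raag_one (V : finType) (e : rel V) : raag e := raag_of_word e [::].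
Definition raag_mul (V : finType) (e : rel V) (x y : raag e) : raag e :=
  raag_of_word e (repr x ++ repr y).
Definition raag_inv (V : finType) (e : rel V) (x : raag e) : raag e :=
  raag_of_word e (inv_word (repr x)).

Lemma raag_mulE (V : finType) (e : rel V) w1 w2 :
  raag_mul (raag_of_word e w1) (raag_of_word e w2) = raag_of_word e (w1 ++ w2).
Proof.
by apply/raag_of_wordP/raag_eq_cat; apply/raag_of_wordP/raag_of_wordK.
Qed.

Lemma raag_invE (V : finType) (e : rel V) w :
  raag_inv (raag_of_word e w) = raag_of_word e (inv_word w).
Proof. by apply/raag_of_wordP/raag_eq_inv/raag_of_wordP/raag_of_wordK. Qed.

Lemma raag_mulA (V : finType) (e : rel V) : associative (@raag_mul V e).
Proof.
move=> x y z; rewrite -(raag_of_wordK x) -(raag_of_wordK y) -(raag_of_wordK z).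
by rewrite !raag_mulE catA.
Qed.

Lemma raag_mul1 (V : finType) (e : rel V) :
  left_id (raag_one e) (@raag_mul V e).
Proof. by move=> x; rewrite -(raag_of_wordK x) raag_mulE. Qed.

Lemma raag_mulr1 (V : finType) (e : rel V) :
  right_id (raag_one e) (@raag_mul V e).
Proof. by move=> x; rewrite -(raag_of_wordK x) raag_mulE cats0. Qed.

Lemma raag_mulV (V : finType) (e : rel V) :
  left_inverse (raag_one e) (@raag_inv V e) (@raag_mul V e).
Proof.
move=> x; rewrite -(raag_of_wordK x) raag_invE raag_mulE.
exact/raag_of_wordP/raag_eq_Vmul.
Qed.

Lemma raag_mulrV (V : finType) (e : rel V) :
  right_inverse (raag_one e) (@raag_inv V e) (@raag_mul V e).
Proof.
move=> x; rewrite -(raag_of_wordK x) raag_invE raag_mulE.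
exact/raag_of_wordP/raag_eq_mulV.
Qed.

HB.instance Definition _ (V : finType) (e : rel V) :=
  isGroup.Build (raag e) (@raag_mulA V e) (@raag_mul1 V e) (@raag_mulr1 V e)
    (@raag_mulV V e) (@raag_mulrV V e).

Definition raag_gen (V : finType) (e : rel V) (v : V) : raag e :=
  raag_of_word e [:: (v, false)].

(** * Subgroups, cosets and the coset intersection complex *)

Definition is_subgroup (G : groupType) (H : set G) : Prop :=
  group_closed (mem H).

Definition subgroup_gen (G : groupType) (S : set G) : set G :=
  smallest (@is_subgroup G) S.

Definition abelian_set (G : groupType) (H : set G) : Prop :=
  forall x y, H x -> H y -> commute x y.

Definition standard_subgroup (V : finType) (e : rel V) (H : set (raag e)) :=
  exists A : set V, H = subgroup_gen (@raag_gen V e @` A).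

Definition maximal_standard_abelian (V : finType) (e : rel V) :
    set (set (raag e)) :=
  [set P | [/\ standard_subgroup P, abelian_set P
    & forall H, standard_subgroup H -> abelian_set H -> P `<=` H -> H = P]].

Definition left_coset (G : groupType) (g : G) (P : set G) : set G :=
  [set (g * x)%g | x in P].

Definition conj_subgroup (G : groupType) (g : G) (P : set G) : set G :=
  [set (g * x * g^-1)%g | x in P].

(** [G/PP] as a set of subsets of [G]. *)
Definition left_cosets (G : groupType) (PP : set (set G)) : set (set G) :=
  [set C | exists g P, PP P /\ C = left_coset g P].

(** The set of simplices is closed under nonempty subsets; the vertices of the
    complex are the [v] such that [[fset v]] is a simplex. *)
Record scomplex (V : choiceType) := SComplex {
  simplex : set {fset V};
  simplex_neq0 : forall s, simplex s -> s != fset0;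
  simplex_face : forall s t, simplex s -> t != fset0 -> (t `<=` s)%fset ->
    simplex t }.

(** The intersection of the [g P g^-1] for [g P] in [s].  It ranges over all
    the ways [(g, P)] of writing the members of [s]; this is harmless since,
    for subgroups, [g P g^-1 = C C^-1] only depends on the coset [C = g P]. *)
Definition coset_intersection (G : groupType) (PP : set (set G))
    (s : {fset set G}) : set G :=
  \bigcap_(gP in [set gP : G * set G | PP gP.2 /\ left_coset gP.1 gP.2 \in s])
    conj_subgroup gP.1 gP.2.

Definition coset_simplex (G : groupType) (PP : set (set G)) :
    set {fset set G} :=
  [set s | [/\ s != fset0, [set` s] `<=` left_cosets PP
    & infinite_set (coset_intersection PP s)]].

Lemma coset_simplex_neq0 (G : groupType) (PP : set (set G)) s :
  coset_simplex PP s -> s != fset0.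
Proof. by case. Qed.

Lemma coset_simplex_face (G : groupType) (PP : set (set G)) s t :
  coset_simplex PP s -> t != fset0 -> (t `<=` s)%fset -> coset_simplex PP t.
Proof.
move=> [_ sPP sI] t0 /fsubsetP ts; split=> // [C /= /ts /sPP //|].
by apply: sub_infinite_set sI => x xs gP [PPgP /ts gPs]; apply: xs.
Qed.

(** If the members of [PP] are infinite, as is the case for the maximal
    standard abelian subgroups of a nontrivial right-angled Artin group, then
    every element of [left_cosets PP] is a vertex. *)
Definition coset_intersection_complex (G : groupType) (PP : set (set G)) :
    scomplex (set G) :=
  SComplex (@coset_simplex_neq0 G PP) (@coset_simplex_face G PP).

(** A graph as a one-dimensional complex. *)
Definition graph_simplex (V : choiceType) (e : rel V) : set {fset V} :=
  [set s | [/\ s != fset0, (#|` s| <= 2)%N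
    & {in s &, forall u v, u != v -> e u v}]].

Lemma graph_simplex_neq0 (V : choiceType) (e : rel V) s :
  graph_simplex e s -> s != fset0.
Proof. by case. Qed.

Lemma graph_simplex_face (V : choiceType) (e : rel V) s t :
  graph_simplex e s -> t != fset0 -> (t `<=` s)%fset -> graph_simplex e t.
Proof.
move=> [_ s2 se] t0 ts; split=> //.
  exact: leq_trans (fsubset_leq_card ts) s2.
by move=> u v /(fsubsetP ts) us /(fsubsetP ts) vs; apply: se.
Qed.

Definition graph_complex (V : choiceType) (e : rel V) : scomplex V :=
  SComplex (@graph_simplex_neq0 V e) (@graph_simplex_face V e).

(** * The length metric on the geometric realization *)

(** A point is given by its barycentric coordinates. *)
Record realization (R : realType) (V : choiceType) (K : scomplex V) := Point {
  bary :> {fsfun V -> R with 0};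
  bary_supp : simplex K (finsupp bary);
  bary_ge0 : forall v, 0 <= bary v;
  bary_sum1 : \sum_(v <- finsupp bary) bary v = 1 }.

(** The Euclidean distance in the regular simplex whose vertices are the
    [e_v / sqrt 2], for [e_v] orthonormal: the edges have length 1. *)
Definition simplex_dist (R : realType) (V : choiceType) (K : scomplex V)
    (x y : realization R K) : R :=
  Num.sqrt
    (2^-1 * \sum_(v <- (finsupp x `|` finsupp y)%fset) (x v - y v) ^+ 2).

Definition in_common_simplex (R : realType) (V : choiceType) (K : scomplex V)
    (x y : realization R K) : Prop :=
  exists s, [/\ simplex K s, (finsupp x `<=` s)%fset & (finsupp y `<=` s)%fset].

(** [is_string x p y]: [x :: p] is a piecewise linear path from [x] to [y], any
    two consecutive points lying in a common closed simplex. *)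
Fixpoint is_string (R : realType) (V : choiceType) (K : scomplex V)
    (x : realization R K) (p : seq (realization R K)) (y : realization R K) :
    Prop :=
  if p is z :: p' then in_common_simplex x z /\ is_string z p' y else x = y.

Fixpoint string_length (R : realType) (V : choiceType) (K : scomplex V)
    (x : realization R K) (p : seq (realization R K)) : R :=
  if p is z :: p' then simplex_dist x z + string_length z p' else 0.

(** The infimum of the empty set is [+oo]. *)
Definition length_dist (R : realType) (V : choiceType) (K : scomplex V)
    (x y : realization R K) : \bar R :=
  ereal_inf [set (string_length x p)%:E | p in [set p | is_string x p y]].

(** * Coarse geometry *)

Definition gromov_product (R : realType) (X : Type) (d : X -> X -> \bar R)
    (w x y : X) : R :=
  (fine (d x w) + fine (d y w) - fine (d x y)) / 2.

(** Finiteness of the distances makes the Gromov products meaningful. *)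
Definition gromov_hyperbolic (R : realType) (X : Type) (d : X -> X -> \bar R) :
    Prop :=
  (forall x y, d x y \is a fin_num) /\
  exists2 delta : R, 0 <= delta & forall w x y z : X,
    Num.min (gromov_product d w x y) (gromov_product d w y z) - delta
      <= gromov_product d w x z.

Definition quasi_isometric (R : realType) (X Y : Type)
    (dX : X -> X -> \bar R) (dY : Y -> Y -> \bar R) : Prop :=
  exists (f : X -> Y) (L C : R), [/\ 1 <= L, 0 <= C,
    forall x x', (L^-1%:E * dX x x' - C%:E <= dY (f x) (f x')
                  <= L%:E * dX x x' + C%:E)%E
  & forall y, exists x, (dY (f x) y <= C%:E)%E].

(** A tree is realized as a metric graph with edges of length 1. *)
Definition quasi_isometric_to_tree (R : realType) (X : Type)
    (d : X -> X -> \bar R) : Prop :=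
  exists (T : choiceType) (t : rel T),
    is_tree t /\ quasi_isometric d (@length_dist R T (graph_complex t)).

(* Main.v *)
Require Import Defs.
From mathcomp Require Import all_boot all_order all_fingroup all_algebra reals.
From mathcomp Require Import finmap boolp classical_sets functions cardinality.
From mathcomp Require Import constructive_ereal ereal zify ring lra.

(** The conjugates [t] of the standard generators play the role of hyperplanes:
    along a word [w], each letter crosses one of them, and the signed number of
    crossings of [t] only depends on the group element spelled by [w].  In a
    shortest word no [t] is crossed in both directions, so every [t] crossed by
    it has a nonzero winding.  This cocycle gives the centralizers of the
    generators, hence shows that a set of flats [g <a, b>] is a simplex exactly
    when all its members contain the axis of a common [t], and that two such
    maximal simplices share at most one vertex.  It also shows that the flats
    near those containing [t] separate flats on different sides of [t], so that
    in the graph of flats every path from [x] to [y] passes near each flat met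
    by a shortest word from [x] to [y].

    This bottleneck property bounds the diameter of the clusters of the graph:
    the components of the complement of a ball about a base point, restricted
    to the boundary sphere.  Ordered by inclusion of the components they form a
    tree, and the distance is, up to a bounded error, the one measured through
    the level at which two clusters separate; this is an ultrametric condition
    on levels and yields the four-point inequality.

    As maximal simplices share at most a vertex, the length metric between
    vertices of the complex is the distance in the graph of flats. *)

Set Implicit Arguments.
Unset Strict Implicit.
Unset Printing Implicit Defensive.

Import Order.TTheory GRing.Theory Num.Theory.

(** * Layering trees of graphs with bottlenecks *)

Section GraphDistance.
Variables (X : choiceType) (adj : rel X).

Definition walk (x y : X) (n : nat) : Prop :=
  exists2 p, path adj x p & last x p = y /\ size p = n.

(** In a connected graph the set is a singleton; between distinct components the value would be the
    default 0. *)
Definition gdist (x y : X) : nat :=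
  xget 0 [set n | walk x y n /\ forall m, walk x y m -> n <= m]%classic.

(** A coarse form of Manning's bottleneck criterion for quasi-trees: a chain with jumps of length at
    most [D] takes the place of a geodesic. *)
Definition bottleneck (D r : nat) : Prop := forall x y, exists c,
  [/\ path (fun u v => gdist u v <= D) x c, last x c = y
    & forall q, path adj x q -> last x q = y ->
      forall z, z \in c -> exists2 u, u \in x :: q & gdist u z <= r].

Hypotheses (adj_sym : symmetric adj) (adj_conn : connected_graph adj).

Lemma walk_cat x y z m n : walk x y m -> walk y z n -> walk x z (m + n).
Proof.
move=> [p px [pl <-]] [q qy [ql <-]]; exists (p ++ q).
  by rewrite cat_path px pl.
by rewrite last_cat pl ql size_cat.
Qed.

Lemma walk_sym x y n : walk x y n -> walk y x n.
Proof.
move=> [p px [<- <-]]; exists (rev (belast x p)).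
  by rewrite rev_path (eq_path (e' := adj)) // => u v; apply: adj_sym.
split; last by rewrite size_rev size_belast.
by case: p px => [|z p] //= _; rewrite rev_cons last_rcons.
Qed.

Lemma gdistP x y : walk x y (gdist x y) /\
  forall m, walk x y m -> gdist x y <= m.
Proof.
rewrite /gdist; apply: (@xgetPex _ _ [set n | walk x y n /\
  forall m, walk x y m -> n <= m]%classic).
have [_ /(_ x y) [p px pl]] := adj_conn.
have ex : exists n, `[< walk x y n >].
  by exists (size p); apply/asboolP; exists p.
case: (ex_minnP ex) => n /asboolP nw nmin; exists n; split => // m mw.
exact/nmin/asboolP.
Qed.

Lemma gdist_walk x y : walk x y (gdist x y).
Proof. by case: (gdistP x y). Qed.

Lemma gdist_min x y m : walk x y m -> gdist x y <= m.
Proof. by case: (gdistP x y) => _; apply. Qed.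

Lemma gdist_path x p : path adj x p -> gdist x (last x p) <= size p.
Proof. by move=> px; apply: gdist_min; exists p. Qed.

Lemma gdistxx x : gdist x x = 0.
Proof. by have := gdist_path (x := x) (p := [::]) isT; rewrite leqn0 => /eqP. Qed.

Lemma gdistC x y : gdist x y = gdist y x.
Proof.
by apply/eqP; rewrite eqn_leq !gdist_min //; apply/walk_sym/gdist_walk.
Qed.

Lemma gdist_tri y x z : gdist x z <= gdist x y + gdist y z.
Proof. by apply/gdist_min/(walk_cat (y := y)); apply: gdist_walk. Qed.

Lemma gdist_adj x y : adj x y -> gdist x y <= 1.
Proof.
by move=> xy; apply: (gdist_path (p := [:: y])); rewrite /= xy.
Qed.

Lemma mem_geodesic x p y z : path adj x p -> last x p = y ->
  size p = gdist x y -> z \in x :: p -> gdist x z + gdist z y = gdist x y.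
Proof.
move=> + + + zp; case/splitPl: zp => p1 p2 zE; rewrite cat_path last_cat zE.
move=> /andP[p1x p2z] p2y; rewrite size_cat => ps.
have := gdist_tri z x y.
have : gdist x z <= size p1 by apply: gdist_min; exists p1.
have : gdist z y <= size p2 by apply: gdist_min; exists p2.
by move: (size p1) (size p2) ps => m n *; lia.
Qed.

End GraphDistance.

(** * Levels about a base point and connectedness outside balls *)

Section Layers.
Variables (X : choiceType) (adj : rel X) (o : X).
Hypotheses (adj_sym : symmetric adj) (adj_conn : connected_graph adj).

Local Notation d := (gdist adj).
Local Notation rho := (gdist adj o).

Definition outer_conn (n : nat) (x y : X) : Prop :=
  exists2 p, path adj x p & last x p = y /\ all (fun z => n <= rho z) (x :: p).

Local Notation conn := outer_conn.

(** The classes of [conn n] on the sphere of radius [n] are the clusters of the layering partition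
    based at [o]. *)
Definition bounded_clusters (D : nat) : Prop := forall n x y,
  rho x = n -> rho y = n -> conn n x y -> d x y <= D.

Lemma outer_conn_refl n x : n <= rho x -> conn n x x.
Proof. by move=> nx; exists [::] => //=; rewrite nx. Qed.

Lemma outer_conn_trans n y x z : conn n x y -> conn n y z -> conn n x z.
Proof.
move=> [p px [pl /= /andP[nx pn]]] [q qy [ql /= /andP[ny qn]]]; exists (p ++ q).
  by rewrite cat_path px pl.
by rewrite last_cat pl ql /= all_cat nx pn qn.
Qed.

Lemma outer_conn_sym n x y : conn n x y -> conn n y x.
Proof.
move=> [p px [<- pn]]; exists (rev (belast x p)).
  by rewrite rev_path (eq_path (e' := adj)) // => u v; apply: adj_sym.
split; first by case: p px {pn} => [|z p] //= _; rewrite rev_cons last_rcons.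
by move: pn; rewrite lastI all_rcons /= => /andP[-> pn]; rewrite all_rev.
Qed.

Lemma outer_conn_le k n x y : k <= n -> conn n x y -> conn k x y.
Proof.
move=> kn [p px [pl pn]]; exists p => //; split => //.
by apply: sub_all pn => z; apply: leq_trans.
Qed.

Lemma outer_conn_ge n x y : conn n x y -> n <= rho x /\ n <= rho y.
Proof.
move=> [p px [<- pn]]; split; first by case/andP: pn.
exact: (allP pn _ (mem_last _ _)).
Qed.

Lemma outer_conn_adj n x y : adj x y -> n <= rho x -> n <= rho y -> conn n x y.
Proof. by move=> xy nx ny; exists [:: y]; rewrite /= ?xy ?nx ?ny. Qed.

Lemma gdist_pred x k : rho x = k.+1 -> exists2 y, adj y x & rho y = k.
Proof.
have [p] := gdist_walk adj_conn o x => + [pl ps] => + xk.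
case/lastP: p pl ps => [|p z]; first by rewrite xk.
rewrite last_rcons size_rcons rcons_path xk => -> [sp] /andP[px yx].
have py := gdist_path adj_conn px; exists (last o p); first by [].
move: (last o p) yx py => y yx py.
have := gdist_tri adj_conn y o x; have := gdist_adj adj_conn yx; lia.
Qed.

(** Descend from [x] towards [o] one level at a time, stopping at level [n]: the descent never
    leaves the complement of the open ball. *)
Lemma ancestor n x : n <= rho x ->
  exists y, [/\ rho y = n, conn n x y & d x y <= rho x - n].
Proof.
move: {2}(rho x - n) (erefl (rho x - n)) => k; elim: k x => [|k ih] x xk nx.
  exists x; split; [by lia|exact: outer_conn_refl|].
  by rewrite gdistxx.
have [|y yx yk] := @gdist_pred x (n + k); first by lia.
have [||z [zn yz dyz]] := ih y; [by lia|by lia|].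
exists z; split => //.
  apply: outer_conn_trans yz; apply: outer_conn_adj; [|by lia|by lia].
  by rewrite adj_sym.
have := gdist_tri adj_conn y x z; have := gdist_adj adj_conn yx.
by rewrite (gdistC adj_sym adj_conn y x); lia.
Qed.

(** A point of the chain is close both to the outer path and to the union of
    the two geodesics to [o], hence close to one of [x], [y]; the chain jumps
    from the neighbourhood of [x] to the one of [y] in a single step. *)
Lemma bottleneck_bounded_clusters D r :
  bottleneck adj D r -> bounded_clusters (6 * r + D).
Proof.
move=> bot n x y xn yn [p px [pl pn]].
have [c [cD cl cq]] := bot x y.
have near z : z \in x :: c -> d x z <= 3 * r \/ d y z <= 3 * r.
  rewrite inE => /orP[/eqP ->|zc]; first by left; rewrite gdistxx.
  have [u up du] := cq p px pl z zc.
  have nu : n <= rho u by apply: (allP pn).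

  have [b bo [bl sb]] := gdist_walk adj_conn o y.
  have [a' a'x [a'l sa']] := gdist_walk adj_conn x o.
  have ab : path adj x (a' ++ b) by rewrite cat_path a'x a'l.
  have [|v vab dv] := cq _ ab _ z zc; first by rewrite last_cat a'l.
  (* Both [u] and [v] are within [r] of [z] and [u] has level at least [n], so [v] has level at
     least [n - 2r]. Lying on a geodesic from [o] to [x] or [y], it is within [2r] of that end,
     which puts [z] within [3r]. *)
  have duz := gdist_tri adj_conn z o u.
  have dvz := gdist_tri adj_conn v o z.
  rewrite (gdistC adj_sym adj_conn z u) in duz.
  have : v \in x :: a' \/ v \in o :: b.
    move: vab; rewrite inE mem_cat => /or3P[vx|va|vb].
    - by left; rewrite inE vx.
    - by left; rewrite inE va orbT.
    - by right; rewrite inE vb orbT.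
  case=> hv.
  - left; have := mem_geodesic adj_conn a'x a'l sa' hv.
    rewrite (gdistC adj_sym adj_conn x o) (gdistC adj_sym adj_conn v o).
    by have := gdist_tri adj_conn v x z; lia.
  - right; have := mem_geodesic adj_conn bo bl sb hv.
    rewrite (gdistC adj_sym adj_conn v y).
    by have := gdist_tri adj_conn v y z; lia.
clear cq; have : forall z, d x z <= 3 * r -> path (fun u v => d u v <= D) z c ->
    (forall w, w \in c -> d x w <= 3 * r \/ d y w <= 3 * r) ->
    last z c = y -> d x y <= 6 * r + D.
  elim: c {cD cl near} => [|w c ih] z xz /=.
    by move=> _ _ <-; lia.
  move=> /andP[zw wc] nr ly.
  have [xw|yw] := nr w (mem_head _ _).
    by apply: (ih w) => // v vc; apply: nr; rewrite inE vc orbT.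
  have := gdist_tri adj_conn z x y; have := gdist_tri adj_conn w z y.
  by rewrite (gdistC adj_sym adj_conn w y); lia.
move=> /(_ x); apply; [by rewrite gdistxx|exact: cD| |exact: cl].
by move=> w wc; apply: near; rewrite inE wc orbT.
Qed.

(** * The four-point inequality and the tree of clusters *)

Section Clusters.
Variable D : nat.
Hypothesis clD : bounded_clusters D.

(** The ancestors of [x] and [y] at level [n] lie in one cluster, so going down, across the cluster
    and up again gives a short enough walk. *)
Lemma outer_conn_gdist n x y : conn n x y -> d x y + 2 * n <= rho x + rho y + D.
Proof.
move=> xy; have [nx ny] := outer_conn_ge xy.
have [x' [x'n xx' dx]] := ancestor nx; have [y' [y'n yy' dy]] := ancestor ny.
have x'y' : conn n x' y'.
  apply: outer_conn_trans yy'; apply: outer_conn_trans xy.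
  exact: outer_conn_sym.
have := clD x'n y'n x'y'.
have := gdist_tri adj_conn x' x y; have := gdist_tri adj_conn y' x' y.
by rewrite (gdistC adj_sym adj_conn y' y); lia.
Qed.

(** Together with [outer_conn_gdist], this identifies the level [n] at which [x] and [y] separate
    with their Gromov product at [o], up to [D / 2]. *)
Lemma split_level x y : exists n,
  [/\ conn n x y, forall k, conn k x y -> k <= n
    & rho x + rho y <= d x y + 2 * n].
Proof.
have [p px [pl ps]] := gdist_walk adj_conn x y.
(* By the triangle inequality, no point of a geodesic from [x] to [y] has level below the Gromov
   product, rounded up because levels are integers. *)
have c0 : conn (uphalf (rho x + rho y - d x y)) x y.
  exists p => //; split=> //; apply/allP => z zp.
  have := mem_geodesic adj_conn px pl ps zp.
  have := gdist_tri adj_conn z o x; have := gdist_tri adj_conn z o y.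
  by rewrite (gdistC adj_sym adj_conn z x); lia.
have ex : exists n, `[< conn n x y >] by eexists; apply/asboolP/c0.
have bd k : `[< conn k x y >] -> k <= rho x by move/asboolP/outer_conn_ge => [].
case: (ex_maxnP ex bd) => n /asboolP nxy nmax; exists n; split => //.
  by move=> k kxy; apply/nmax/asboolP.
by have /asboolP/nmax := c0; lia.
Qed.

(** By transitivity of [conn], separation levels satisfy the ultrametric inequality. Its four
    instances bounding the levels [f] of [x], [z] and [g] of [y], [w] from below give
    [f + g >= minn (a + b) (c + e)]; the upper bounds on the two distances on the left cost [D]
    each. *)
Lemma four_point x y z w :
  d x z + d y w <= maxn (d x y + d z w) (d y z + d x w) + 2 * D.
Proof.
have [a [axy am al]] := split_level x y; have [b [bzw bm bl]] := split_level z w.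
have [c [cyz cm cl]] := split_level y z; have [e [exw em el]] := split_level x w.
have [f [fxz fm fl]] := split_level x z; have [g [gyw gm gl]] := split_level y w.
have := outer_conn_gdist fxz; have := outer_conn_gdist gyw.
have tr i j u v t : conn i u v -> conn j v t -> conn (minn i j) u t.
  move=> uv vt; apply: (@outer_conn_trans _ v).
    by apply: outer_conn_le uv; apply: geq_minl.
  by apply: outer_conn_le vt; apply: geq_minr.
have := fm _ (tr _ _ _ _ _ axy cyz).
have := fm _ (tr _ _ _ _ _ exw (outer_conn_sym bzw)).
have := gm _ (tr _ _ _ _ _ (outer_conn_sym axy) exw).
have := gm _ (tr _ _ _ _ _ cyz bzw).
by clear -al bl cl el fl gl; lia.
Qed.

(** The choice made by [xget] depends only on the set, so all members of a cluster get the same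
    representative. *)
Definition cluster_rep (x : X) : X :=
  xget o [set y | rho y = rho x /\ conn (rho x) x y]%classic.

Lemma cluster_repP x : rho (cluster_rep x) = rho x /\
  conn (rho x) x (cluster_rep x).
Proof.
apply: (@xgetPex _ _ [set y | rho y = rho x /\ conn (rho x) x y]%classic).
by exists x; split => //; apply: outer_conn_refl.
Qed.

Lemma cluster_rep_eq x y : rho x = rho y -> conn (rho x) x y ->
  cluster_rep x = cluster_rep y.
Proof.
move=> xy cxy; rewrite /cluster_rep; congr xget; apply/seteqP.
split=> z /= [zr cz].
- rewrite -xy; split => //.
  by apply: outer_conn_trans cz; apply: outer_conn_sym.
- rewrite xy in cxy *; split => //.
  by apply: outer_conn_trans cz.
Qed.

Lemma cluster_rep_id x : cluster_rep (cluster_rep x) == cluster_rep x.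
Proof.
have [rx cx] := cluster_repP x; apply/eqP/cluster_rep_eq => //.
by rewrite rx; apply: outer_conn_sym.
Qed.

(** A cluster is represented by a canonical member, so that the clusters form a
    subtype of [X]. *)
Definition layer_tree : choiceType := {x : X | cluster_rep x == x}.

Definition to_layer_tree (x : X) : layer_tree :=
  exist _ (cluster_rep x) (cluster_rep_id x).

Definition is_parent (A B : layer_tree) : bool :=
  `[< rho (val B) = (rho (val A)).+1 /\ conn (rho (val A)) (val A) (val B) >].

Definition layer_adj : rel layer_tree := fun A B => is_parent A B || is_parent B A.

Lemma to_layer_treeK A : to_layer_tree (val A) = A.
Proof. by apply: val_inj => /=; apply/eqP; case: A. Qed.

Lemma layer_adj_sym : symmetric layer_adj.
Proof. by move=> A B; rewrite /layer_adj orbC. Qed.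

Lemma layer_adj_irr : irreflexive layer_adj.
Proof.
move=> A; rewrite /layer_adj orbb; apply/asboolP => -[h _]; by lia.
Qed.

Lemma parent_uniq A B C : is_parent A C -> is_parent B C -> A = B.
Proof.
move=> /asboolP[ca ac] /asboolP[cb bc]; have ab : rho (val A) = rho (val B) by lia.
rewrite -(to_layer_treeK A) -(to_layer_treeK B); apply: val_inj => /=.
apply: cluster_rep_eq => //; apply: outer_conn_trans ac _.
by rewrite ab; apply: outer_conn_sym.
Qed.

Lemma to_layer_tree_adj x y : adj x y ->
  to_layer_tree x = to_layer_tree y \/ layer_adj (to_layer_tree x) (to_layer_tree y).
Proof.
wlog xy : x y / rho x <= rho y.
  move=> h; case/orP: (leq_total (rho x) (rho y)) => [/h//|yx xy].
  have [|-> //|] := h y x yx; [by rewrite adj_sym|by left|].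
  by rewrite layer_adj_sym; right.
move=> axy; have cxy : conn (rho x) x y by apply: outer_conn_adj.
have [rx cx] := cluster_repP x; have [ry cy] := cluster_repP y.
case: (eqVneq (rho x) (rho y)) => [e|ne].
  by left; apply: val_inj => /=; apply: cluster_rep_eq.
right; apply/orP; left; apply/asboolP => /=; rewrite rx ry; split.
  by have := gdist_tri adj_conn x o y; have := gdist_adj adj_conn axy; lia.
apply: (outer_conn_trans (outer_conn_sym cx)); apply: (outer_conn_trans cxy).
exact: outer_conn_le cy.
Qed.

Lemma to_layer_tree_path x p : path adj x p -> exists q,
  [/\ path layer_adj (to_layer_tree x) q,
      last (to_layer_tree x) q = to_layer_tree (last x p)
    & size q <= size p].
Proof.
elim: p x => [|y p ih] x /=; first by exists [::].
move=> /andP[/to_layer_tree_adj xy /ih[q [yq ql qs]]].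
case: xy => [->|xy]; first by exists q; split => //; apply: leqW.
by exists (to_layer_tree y :: q); rewrite /= xy yq.
Qed.

Lemma is_tree_layer : is_tree layer_adj.
Proof.
split; [exact: layer_adj_sym|exact: layer_adj_irr| |].
  split; first by constructor; apply: (to_layer_tree o).
  move=> A B; have [_ /(_ (val A) (val B)) [p px pl]] := adj_conn.
  have [q [qA ql _]] := to_layer_tree_path px.
  exists q; first by rewrite -{1}(to_layer_treeK A).
  by rewrite -{1}(to_layer_treeK A) ql pl to_layer_treeK.
move=> c /andP[cyc unc]; case: leqP => // sc.
(* A vertex of maximal level on a circuit would have two distinct parents. *)
have [A Ac Amax] : exists2 A, A \in c &
    forall B, B \in c -> rho (val B) <= rho (val A).
  have : 0 < size c by exact: ltnW (ltnW sc).
  elim: c {cyc unc sc} => [|A [|A' c] ih] // _.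
    by exists A; rewrite ?mem_head // => B; rewrite inE => /eqP ->.
  have [B Bc Bmax] := ih isT.
  case/orP: (leq_total (rho (val A)) (rho (val B))) => AB.
    exists B; first by rewrite inE Bc orbT.
    by move=> C; rewrite inE => /orP[/eqP -> //|/Bmax].
  exists A; first exact: mem_head.
  move=> C; rewrite inE => /orP[/eqP -> //|/Bmax CB].
  exact: leq_trans CB AB.
have up B : B \in c -> layer_adj A B -> is_parent B A.
  move=> /Amax BA /orP[/asboolP[h _]|//].
  by move: BA; rewrite h ltnn.
have [i p cE] := rot_to Ac.
have pc B : B \in A :: p -> B \in c by rewrite -cE mem_rot.
move: cyc unc sc pc; rewrite -(rot_cycle i) -(rot_uniq i) -(size_rot i) cE.
case: p {cE} => [|B p] //; case/lastP: p => [|p C] //.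
rewrite /= rcons_path last_rcons => /andP[AB /andP[_ CA]] /and3P[_ BpC _] _ pc.
have BA : is_parent B A by apply: up => //; apply: pc; rewrite !inE eqxx orbT.
have {}CA : is_parent C A.
  apply: up; last by rewrite layer_adj_sym.
  by apply: pc; rewrite !inE mem_rcons mem_head !orbT.
by move: BpC; rewrite (parent_uniq BA CA) mem_rcons mem_head.
Qed.

(** A neighbour of the child one level down lies in the parent cluster, hence within [D] of its
    representative. *)
Lemma layer_adj_gdist A B : layer_adj A B -> d (val A) (val B) <= D.+1.
Proof.
wlog AB : A B / is_parent A B.
  move=> h /orP[AB|BA]; first by apply: h => //; rewrite /layer_adj AB.
  by rewrite (gdistC adj_sym adj_conn); apply: h => //; rewrite /layer_adj BA.
move: AB => /asboolP[lB AB] _.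
have [C CB lC] := gdist_pred lB.
have BC : conn (rho (val A)) (val B) C.
  by apply: outer_conn_adj; [rewrite adj_sym|lia|lia].
have := clD erefl lC (outer_conn_trans AB BC).
have := gdist_adj adj_conn CB.
by have := gdist_tri adj_conn C (val A) (val B); lia.
Qed.

Lemma layer_path_gdist A q : path layer_adj A q ->
  d (val A) (val (last A q)) <= D.+1 * size q.
Proof.
elim: q A => [|B q ih] A /=; first by rewrite gdistxx.
move=> /andP[/layer_adj_gdist AB /ih Bq].
rewrite mulnS; apply: leq_trans (gdist_tri adj_conn (val B) _ _) _.
exact: leq_add.
Qed.

Lemma gdist_cluster_rep x : d x (cluster_rep x) <= D.
Proof. by have [rx cx] := cluster_repP x; apply: (clD erefl). Qed.

End Clusters.
End Layers.

(** * The length metric of complexes whose maximal simplices share vertices only *)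

Section Minkowski.
Local Open Scope ring_scope.
Variables (R : rcfType) (I : Type).
Implicit Types (r : seq I) (f g : I -> R).

Lemma cauchy_schwarz_sum r f g :
  (\sum_(j <- r) f j * g j) ^+ 2 <=
    (\sum_(j <- r) f j ^+ 2) * (\sum_(j <- r) g j ^+ 2).
Proof.
have pos h : 0 <= \sum_(j <- r) h j ^+ 2 :> R by apply: sumr_ge0 => j _; apply: sqr_ge0.
elim: r pos => [|j r ih] pos; first by rewrite !big_nil mul0r expr0n.
rewrite !big_cons; set A := \sum_(j <- r) f j ^+ 2 in ih *.
set B := \sum_(j <- r) g j ^+ 2 in ih *; set C := \sum_(j <- r) f j * g j in ih *.
have A0 : 0 <= A by apply: sumr_ge0 => k _; apply: sqr_ge0.
have B0 : 0 <= B by apply: sumr_ge0 => k _; apply: sqr_ge0.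
have {}ih : C ^+ 2 <= A * B.
  by apply: ih => h; apply: sumr_ge0 => k _; apply: sqr_ge0.
suff : 2 * C * f j * g j <= A * g j ^+ 2 + B * f j ^+ 2 by nra.
move: (f j) (g j) => a b; case: (ltgtP A 0) => [|Ap|A00]; [by lra| |].
  (* The product equals [(A b - C a)^2 + a^2 (A B - C^2)]. Dividing by [A] requires [A > 0]; if
     [A = 0], the induction hypothesis forces [C = 0]. *)
  have h : 0 <= A * (A * b ^+ 2 + B * a ^+ 2 - 2 * C * a * b).
    have := sqr_ge0 (A * b - C * a); have := sqr_ge0 a.
    have : 0 <= a ^+ 2 * (A * B - C ^+ 2) by apply: mulr_ge0; [apply: sqr_ge0|lra].
    by nra.
  by rewrite pmulr_rge0 // in h; lra.
have C0 : C = 0 by apply/eqP; rewrite -sqrf_eq0; apply/eqP; have := sqr_ge0 C; nra.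
by rewrite C0 A00; have := sqr_ge0 a; nra.
Qed.

Lemma minkowski_sum r f g :
  Num.sqrt (\sum_(j <- r) (f j + g j) ^+ 2) <=
    Num.sqrt (\sum_(j <- r) f j ^+ 2) + Num.sqrt (\sum_(j <- r) g j ^+ 2).
Proof.
have pos h : 0 <= \sum_(j <- r) h j ^+ 2 :> R by apply: sumr_ge0 => j _; apply: sqr_ge0.
rewrite -(ler_pXn2r (n := 2)) ?nnegrE ?addr_ge0 ?sqrtr_ge0 // sqrrD !sqr_sqrtr //.
have -> : \sum_(j <- r) (f j + g j) ^+ 2 =
    \sum_(j <- r) f j ^+ 2 + (\sum_(j <- r) f j * g j) *+ 2 + \sum_(j <- r) g j ^+ 2.
  by rewrite -sumrMnl -!big_split; apply: eq_bigr => j _; rewrite sqrrD.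
rewrite lerD2r lerD2l lerMn2r /= -sqrtrM //.
apply: le_trans (ler_norm _) _; rewrite -sqrtr_sqr ler_wsqrtr //.
exact: cauchy_schwarz_sum.
Qed.

End Minkowski.

(** * The Euclidean distance in a simplex, vertices and strings *)

Section SimplexDistance.
Local Open Scope ring_scope.
Variables (R : realType) (V : choiceType) (K : scomplex V).
Implicit Types (x y z : realization R K).

Lemma simplex_distE (S : {fset V}) x y :
  (finsupp x `<=` S)%fset -> (finsupp y `<=` S)%fset ->
  simplex_dist x y = Num.sqrt (2^-1 * \sum_(v <- S) (x v - y v) ^+ 2).
Proof.
move=> xS yS; rewrite /simplex_dist; congr (Num.sqrt (_ * _)).
apply: big_fset_incl; first by rewrite fsubUset xS.
move=> v _; rewrite in_fsetU negb_or => /andP[vx vy].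
by rewrite !fsfun_dflt // subr0 expr0n.
Qed.

Lemma simplex_distC x y : simplex_dist x y = simplex_dist y x.
Proof.
rewrite /simplex_dist fsetUC; congr (Num.sqrt (_ * _)).
by apply: eq_bigr => v _; rewrite -sqrrN opprB.
Qed.

Lemma simplex_dist_ge0 x y : 0 <= simplex_dist x y.
Proof. exact: sqrtr_ge0. Qed.

Lemma simplex_distxx x : simplex_dist x x = 0.
Proof.
rewrite /simplex_dist big1 ?mulr0 ?sqrtr0 // => v _.
by rewrite subrr expr0n.
Qed.

Lemma simplex_dist_tri y x z :
  simplex_dist x z <= simplex_dist x y + simplex_dist y z.
Proof.
set S := (finsupp x `|` finsupp y `|` finsupp z)%fset.
have xS : (finsupp x `<=` S)%fset by rewrite /S -fsetUA fsubsetUl.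
have yS : (finsupp y `<=` S)%fset by rewrite /S fsetUAC fsubsetUr.
have zS : (finsupp z `<=` S)%fset by rewrite /S fsubsetUr.
rewrite !(simplex_distE (S := S)) // !sqrtrM ?invr_ge0 ?ler0n // -mulrDr.
rewrite ler_wpM2l ?sqrtr_ge0 //.
apply: le_trans (minkowski_sum S (fun v => x v - y v) (fun v => y v - z v)).
rewrite ler_wsqrtr // ler_sum // => v _.
by rewrite addrA subrK.
Qed.

Lemma bary_le1 x v : x v <= 1.
Proof.
case: (finsuppP x v) => // vx; rewrite -(bary_sum1 x) (big_fsetD1 v) //= lerDl.
by apply: sumr_ge0 => w _; apply: bary_ge0.
Qed.

Lemma simplex_dist_le1 x y : simplex_dist x y <= 1.
Proof.
rewrite -sqrtr1 ler_wsqrtr // mulrC ler_pdivrMr ?ltr0n // mul1r.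
have sumS z : (finsupp z `<=` finsupp x `|` finsupp y)%fset ->
    \sum_(v <- (finsupp x `|` finsupp y)%fset) z v = 1.
  move=> zS; rewrite -(bary_sum1 z); apply/esym/big_fset_incl => // v _.
  exact: fsfun_dflt.
(* For coordinates in [0, 1], [(a - b)^2 <= a + b], and the coordinates of both points together sum
   to 2. *)
have -> : 2 = \sum_(v <- (finsupp x `|` finsupp y)%fset) (x v + y v).
  by rewrite big_split /= !sumS ?fsubsetUl ?fsubsetUr.
apply: ler_sum => v _.
have := bary_ge0 x v; have := bary_ge0 y v.
by have := bary_le1 x v; have := bary_le1 y v; nra.
Qed.

Lemma finsupp_neq0 x : exists v, v \in finsupp x.
Proof. exact/fset0Pn/(simplex_neq0 (bary_supp x)). Qed.

Definition vertex_fun (v : V) : {fsfun V -> R with 0} :=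
  [fsfun w in [fset v]%fset => 1 | 0].

Lemma vertex_funE v w : vertex_fun v w = (w == v)%:R.
Proof. by rewrite /vertex_fun fsfun_fun in_fset1; case: eqP. Qed.

Lemma finsupp_vertex_fun v : finsupp (vertex_fun v) = [fset v]%fset.
Proof.
apply/fsetP => w; rewrite mem_finsupp vertex_funE in_fset1.
by case: (w == v); rewrite ?oner_eq0 ?eqxx.
Qed.

Lemma vertex_point_subproof v (vK : simplex K [fset v]%fset) :
  [/\ simplex K (finsupp (vertex_fun v)), forall w, 0 <= vertex_fun v w
    & \sum_(w <- finsupp (vertex_fun v)) vertex_fun v w = 1].
Proof.
rewrite finsupp_vertex_fun; split => // [w|]; first by rewrite vertex_funE ler0n.
by rewrite big_seq_fset1 vertex_funE eqxx.
Qed.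

Definition vertex_point v (vK : simplex K [fset v]%fset) : realization R K :=
  let: And3 h1 h2 h3 := vertex_point_subproof vK in Point h1 h2 h3.

Lemma vertex_pointE v (vK : simplex K [fset v]%fset) :
  bary (vertex_point vK) = vertex_fun v.
Proof. by rewrite /vertex_point; case: vertex_point_subproof. Qed.

Lemma finsupp_vertex v (vK : simplex K [fset v]%fset) :
  finsupp (vertex_point vK) = [fset v]%fset.
Proof. by rewrite vertex_pointE finsupp_vertex_fun. Qed.

Lemma simplex_dist_vertex v w (vK : simplex K [fset v]%fset)
    (wK : simplex K [fset w]%fset) :
  v != w -> simplex_dist (vertex_point vK) (vertex_point wK) = 1.
Proof.
move=> vw; rewrite /simplex_dist !vertex_pointE !finsupp_vertex_fun.
rewrite big_fsetU1 ?in_fset1 // big_seq_fset1 !vertex_funE !eqxx (eq_sym w) (negPf vw).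
by rewrite subr0 sub0r sqrrN expr1n mulVf ?sqrtr1 // pnatr_eq0.
Qed.

Lemma eq_vertex_point x v (vK : simplex K [fset v]%fset) :
  finsupp x = [fset v]%fset -> bary x = bary (vertex_point vK).
Proof.
move=> xv; apply/fsfunP => w; rewrite vertex_pointE vertex_funE.
case: eqP => [->|wv]; last by rewrite fsfun_dflt // xv in_fset1; apply/eqP.
by have := bary_sum1 x; rewrite xv big_seq_fset1.
Qed.

Lemma is_string_cat x p y q z :
  is_string x p y -> is_string y q z -> is_string x (p ++ q) z.
Proof.
elim: p x => [|w p ih] x /=; first by move=> ->.
by move=> [xw wy] yz; split => //; apply: ih.
Qed.

Lemma string_length_cat x p y q : is_string x p y ->
  string_length x (p ++ q) = string_length x p + string_length y q.
Proof.
elim: p x => [|w p ih] x /=; first by move=> ->; rewrite add0r.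
by move=> [_ wy]; rewrite ih // addrA.
Qed.

End SimplexDistance.

(** * Comparison of the length metric with the graph distance on vertices *)

Section GluedComplex.
Local Open Scope ring_scope.
Variables (R : realType) (V : choiceType) (K : scomplex V).
Variables (X : choiceType) (i : X -> V) (adj : rel X).
Hypotheses (i_inj : injective i) (i_vert : forall x, simplex K [fset i x]%fset).
Hypothesis i_surj : forall v, simplex K [fset v]%fset -> exists x, i x = v.
Hypothesis adjP : forall x y, adj x y <-> x != y /\ simplex K [fset i x; i y]%fset.
Hypothesis glue : forall s t v w, simplex K s -> simplex K t -> v != w ->
  v \in s -> w \in s -> v \in t -> w \in t -> simplex K (s `|` t)%fset.

Definition vpt (u : X) : realization R K := vertex_point R (i_vert u).

Lemma vpt_dist u v : u != v -> simplex_dist (vpt u) (vpt v) = 1.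
Proof. by move=> uv; apply: simplex_dist_vertex; apply: contra_neq uv => /i_inj. Qed.

(** Two maximal simplices meet in at most one vertex, so a string that changes
    maximal simplex passes through a vertex, where it can be straightened. *)
Lemma string_to_vertex x p v : is_string x p (vpt v) -> exists u q,
  [/\ path adj u q, last u q = v,
    exists2 s, simplex K s & (finsupp x `<=` s)%fset /\ i u \in s
  & simplex_dist x (vpt u) + (size q)%:R <= string_length x p].
Proof.
elim: p x => [|z p ih] x /=.
  move=> ->; exists v, [::]; split => //; last by rewrite addr0 simplex_distxx.
  exists [fset i v]%fset; first exact: i_vert.
  by rewrite in_fset1 eqxx finsupp_vertex.
move=> [[s [sK xs zs]] /ih[u [q [uq qv [t tK [zt ut]] ql]]]].
have [w wz] := finsupp_neq0 z.
(* If [z] has two vertices in its support, then [s] and [t] share them and [glue] puts [x] and [u]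
   in one simplex, so [z] can be skipped. Otherwise [z] is itself a vertex. *)
have [[w' w'z ww']|zw] : (exists2 w', w' \in finsupp z & w != w') \/ finsupp z = [fset w]%fset.
  case: (pselect (exists2 w', w' \in finsupp z & w != w')); first by left.
  move=> h; right; apply/fsetP => w'; rewrite in_fset1; apply/idP/eqP => [w'z|-> //].
  by apply/eqP; rewrite eq_sym; apply/negPn/negP => ww'; apply: h; exists w'.
  exists u, q; split => //.
    exists (s `|` t)%fset.
      by apply: (glue sK tK ww'); do ?[exact: (fsubsetP zs)|exact: (fsubsetP zt)].
    split; first exact: fsubset_trans xs (fsubsetUl _ _).
    by rewrite in_fsetU ut orbT.
  apply: le_trans (_ : simplex_dist x z + (simplex_dist z (vpt u) + (size q)%:R) <= _).
    by rewrite addrA lerD2r; apply: simplex_dist_tri.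
  by rewrite lerD2l.
have wK : simplex K [fset w]%fset by rewrite -zw; apply: bary_supp.
have [w' w'E] := i_surj wK; subst w.
have bz : bary z = bary (vpt w') by apply: eq_vertex_point.
have dz y : simplex_dist y z = simplex_dist y (vpt w').
  by rewrite /simplex_dist bz.
rewrite simplex_distC dz simplex_distC in ql.
case: (eqVneq w' u) => [w'u|w'u].
  subst u; exists w', q; split => //.
    by exists s => //; split => //; apply: (fsubsetP zs).
  by rewrite dz lerD2l; apply: le_trans ql; rewrite lerDr simplex_dist_ge0.
(* Since [z] is the vertex [w'], distinct from [u], the part of the string after [z] contains a unit
   of length that pays for the edge from [w'] to [u]. *)
exists w', (u :: q); split => //.
- rewrite /= uq andbT; apply/adjP; split => //.
  apply: (simplex_face tK); first by apply/fset0Pn; exists (i u); rewrite !inE eqxx orbT.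
  apply/fsubsetP => y; rewrite !inE => /orP[/eqP ->|/eqP -> //].
  exact: (fsubsetP zt).
- by exists s => //; split => //; apply: (fsubsetP zs).
- by rewrite dz lerD2l; rewrite vpt_dist // in ql; rewrite /= -natr1 addrC.
Qed.

Lemma string_vertices u v p : is_string (vpt u) p (vpt v) -> exists q,
  [/\ path adj u q, last u q = v & (size q)%:R <= string_length (vpt u) p].
Proof.
move=> /string_to_vertex[w [q [wq ql [s sK [us ws]] le]]].
case: (eqVneq u w) => [uw|uw].
  by subst w; exists q; split => //; rewrite simplex_distxx add0r in le.
exists (w :: q); split => //; last by rewrite vpt_dist // in le; rewrite /= -natr1 addrC.
rewrite /= wq andbT; apply/adjP; split => //.
apply: (simplex_face sK); first by apply/fset0Pn; exists (i u); rewrite !inE eqxx.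
apply/fsubsetP => y; rewrite !inE => /orP[/eqP ->|/eqP -> //].
by apply: (fsubsetP us); rewrite finsupp_vertex in_fset1.
Qed.

Lemma path_string u q : path adj u q -> exists p,
  is_string (vpt u) p (vpt (last u q)) /\ string_length (vpt u) p = (size q)%:R.
Proof.
elim: q u => [|w q ih] u /=; first by exists [::].
move=> /andP[/adjP[uw uwK] /ih[p [wp pl]]]; exists (vpt w :: p); split.
  split => //; exists [fset i u; i w]%fset.
  by rewrite !finsupp_vertex !fsub1set !inE !eqxx orbT.
by rewrite /= pl vpt_dist // -natr1 addrC.
Qed.

Definition near_vertex (x : realization R K) (u : X) := i u \in finsupp x.

Lemma near_vertex_ex x : exists u, near_vertex x u.
Proof.
have [v vx] := finsupp_neq0 x.
have [|u uv] := i_surj (v := v).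
  apply: (simplex_face (bary_supp x)); last by rewrite fsub1set.
  by apply/fset0Pn; exists v; rewrite in_fset1.
by exists u; rewrite /near_vertex uv.
Qed.

Lemma near_vertex_vpt u w : near_vertex (vpt u) w -> w = u.
Proof. by rewrite /near_vertex finsupp_vertex in_fset1 => /eqP/i_inj. Qed.

Lemma near_vertex_simplex x u : near_vertex x u ->
  in_common_simplex x (vpt u) /\ in_common_simplex (vpt u) x.
Proof.
move=> xu; split; exists (finsupp x); rewrite finsupp_vertex fsub1set fsubset_refl;
  split => //; exact: bary_supp.
Qed.

(** Prolong the string by the segments from [u] to [x] and from [y] to [v]; each stays in a simplex
    and so has length at most 1. *)
Lemma length_dist_ge_path x y u v : near_vertex x u -> near_vertex y v ->
  forall p, is_string x p y -> exists q,
    [/\ path adj u q, last u q = v & (size q)%:R <= string_length x p + 2].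
Proof.
move=> /near_vertex_simplex[_ xu] /near_vertex_simplex[yv _] p xy.
have s1 : is_string (vpt u) (x :: p) y by split.
have s2 : is_string y [:: vpt v] (vpt v) by split.
have [q [uq ql le]] := string_vertices (is_string_cat s1 s2).
exists q; split => //; apply: le_trans le _.
rewrite (string_length_cat _ s1) /= addr0.
by have := simplex_dist_le1 (vpt u) x; have := simplex_dist_le1 y (vpt v); lra.
Qed.

Lemma length_dist_le_path x y u q : near_vertex x u -> near_vertex y (last u q) ->
  path adj u q -> (length_dist x y <= ((size q)%:R + 2)%:E)%E.
Proof.
move=> /near_vertex_simplex[xu _] /near_vertex_simplex[_ yv].
move=> /path_string[p [up pl]].
have s2 : is_string (vpt (last u q)) [:: y] y by split.
have s1 : is_string x (vpt u :: p) (vpt (last u q)) by split.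
apply: le_trans (_ : (string_length x (vpt u :: p ++ [:: y]))%:E <= _)%E.
  by apply: ereal_inf_lbound; exists (vpt u :: p ++ [:: y]) => //; apply: (is_string_cat s1 s2).
rewrite lee_fin -[_ :: _ ++ _]/((vpt u :: p) ++ [:: y]) (string_length_cat _ s1) /= addr0 pl.
by have := simplex_dist_le1 x (vpt u); have := simplex_dist_le1 (vpt (last u q)) y; lra.
Qed.

Hypothesis adj_conn : connected_graph adj.

Lemma length_dist_gdist x y u v : near_vertex x u -> near_vertex y v ->
  exists2 r : R, length_dist x y = r%:E
    & (gdist adj u v)%:R - 2 <= r <= (gdist adj u v)%:R + 2.
Proof.
move=> xu yv.
have ub : (length_dist x y <= ((gdist adj u v)%:R + 2)%:E)%E.
  have [q uq [ql <-]] := gdist_walk adj_conn u v.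
  by apply: length_dist_le_path uq => //; rewrite ql.
have lb : (((gdist adj u v)%:R - 2)%:E <= length_dist x y)%E.
  apply: le_ereal_inf_tmp => _ [p xy <-]; rewrite lee_fin.
  have [q [uq <- le]] := length_dist_ge_path xu yv xy.
  rewrite lerBlDr; apply: le_trans le.
  by rewrite ler_nat gdist_path.
case: (length_dist x y) lb ub => [r| |] //.
by rewrite !lee_fin => lb ub; exists r => //; rewrite lb.
Qed.

End GluedComplex.

(** * Graphs as an instance of glued complexes *)

Section GraphComplex.
Variables (V : choiceType) (e : rel V).
Hypotheses (e_sym : symmetric e) (e_irr : irreflexive e).
Local Notation K := (graph_complex e).

Lemma graph_complex_vert v : simplex K [fset v]%fset.
Proof.
split; [by apply/fset0Pn; exists v; rewrite in_fset1|by rewrite cardfs1|].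
by move=> x y; rewrite !in_fset1 => /eqP -> /eqP ->; rewrite eqxx.
Qed.

Lemma graph_complex_edge u v : e u v <-> u != v /\ simplex K [fset u; v]%fset.
Proof.
split=> [uv|[uv [_ _ h]]]; last by apply: h; rewrite // !inE eqxx ?orbT.
have nuv : u != v by apply: contraTneq uv => ->; rewrite e_irr.
split => //; split.
- by apply/fset0Pn; exists u; rewrite !inE eqxx.
- by rewrite cardfs2 nuv.
- move=> x y; rewrite !inE => /orP[]/eqP -> /orP[]/eqP ->; rewrite ?eqxx // => _.
  by rewrite e_sym.
Qed.

(** A simplex of a graph containing [v] and [w] has no other vertex, so [s] and [t] coincide. *)
Lemma graph_complex_glue s t v w : simplex K s -> simplex K t -> v != w ->
  v \in s -> w \in s -> v \in t -> w \in t -> simplex K (s `|` t)%fset.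
Proof.
move=> sK tK vw vs ws vt wt.
have two r : simplex K r -> v \in r -> w \in r -> r = [fset v; w]%fset.
  move=> [_ r2 _] vr wr; apply/esym/eqP; rewrite eqEfcard cardfs2 vw r2 andbT.
  by apply/fsubsetP => x; rewrite !inE => /orP[]/eqP ->.
by rewrite (two t) // -(two s) // fsetUid.
Qed.

End GraphComplex.

(** * Hyperbolicity and quasi-isometry with the layering tree *)

Section QuasiTree.
Local Open Scope ring_scope.
Variables (R : realType) (V : choiceType) (K : scomplex V).
Variables (X : choiceType) (i : X -> V) (adj : rel X).
Hypotheses (i_inj : injective i) (i_vert : forall x, simplex K [fset i x]%fset).
Hypothesis i_surj : forall v, simplex K [fset v]%fset -> exists x, i x = v.
Hypothesis adjP : forall x y, adj x y <-> x != y /\ simplex K [fset i x; i y]%fset.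
Hypothesis glue : forall s t v w, simplex K s -> simplex K t -> v != w ->
  v \in s -> w \in s -> v \in t -> w \in t -> simplex K (s `|` t)%fset.
Hypotheses (adj_sym : symmetric adj) (adj_conn : connected_graph adj).
Variables (o : X) (D : nat).
Hypothesis clD : bounded_clusters adj o D.

Local Notation d := (gdist adj).
Local Notation near := (@near_vertex R V K X i).

Let dist_gdist := @length_dist_gdist R V K X i adj i_inj i_vert i_surj adjP glue
  adj_conn.

Theorem bounded_clusters_hyperbolic : gromov_hyperbolic (@length_dist R V K).
Proof.
have nx (x : realization R K) : exists u, near x u by apply: near_vertex_ex.
split=> [x y|].
  have [[u xu] [v yv]] := (nx x, nx y).
  by have [r -> _] := dist_gdist xu yv.
(* In the four-point form, [four_point] contributes [2D] and the passage to vertices changes each of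
   four distances by at most 2; Gromov products halve the total [2D + 8]. *)
exists (D%:R + 4); first by rewrite addr_ge0 ?ler0n.
move=> w x y z; have [[a wa] [b xb] [c yc] [t zt]] := And4 (nx w) (nx x) (nx y) (nx z).
rewrite /gromov_product.
have [xw -> /andP[xw1 xw2]] := dist_gdist xb wa.
have [yw -> /andP[yw1 yw2]] := dist_gdist yc wa.
have [zw -> /andP[zw1 zw2]] := dist_gdist zt wa.
have [xy -> /andP[xy1 xy2]] := dist_gdist xb yc.
have [yz -> /andP[yz1 yz2]] := dist_gdist yc zt.
have [xz -> /andP[xz1 xz2]] := dist_gdist xb zt.
rewrite /= lerBlDr ge_min.
have := four_point adj_sym adj_conn clD b c t a; rewrite addn_maxl leq_max.
by case/orP; rewrite -(ler_nat R) mul2n -addnn !natrD => h; apply/orP; [left|right]; lra.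
Qed.

Theorem bounded_clusters_quasi_tree : quasi_isometric_to_tree (@length_dist R V K).
Proof.
pose T := layer_tree adj o; pose t : rel T := @layer_adj X adj o.
exists T, t; split; first exact: is_tree_layer.
have t_sym : symmetric t by exact: layer_adj_sym.
have t_irr : irreflexive t by exact: layer_adj_irr.
have t_conn : connected_graph t by case: (is_tree_layer o adj_sym adj_conn).
have ts (v : T) : simplex (graph_complex t) [fset v]%fset -> exists x, id x = v.
  by exists v.
pose distT := @length_dist_gdist R T (graph_complex t) T id t (@inj_id T)
  (graph_complex_vert t) ts (graph_complex_edge t_sym t_irr)
  (@graph_complex_glue T t) t_conn.
pose pt (x : realization R K) : X := sval (cid (near_vertex_ex i_surj x)).
have ptP x : near x (pt x) by rewrite /pt; case: cid.
pose F (u : X) : T := to_layer_tree o adj_sym u.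
pose f x := vpt R (@graph_complex_vert T t) (F (pt x)).
have fP x : near_vertex id (f x) (F (pt x)).
  by rewrite /near_vertex finsupp_vertex in_fset1.
(* A tree edge spans at most [D + 1] in the graph and moving both ends to cluster representatives
   costs [2D]; each of the two length metrics differs from its graph distance by at most 2. *)
exists f, D.+1%:R, (2 * D + 4)%:R; split.
- by rewrite ler1n.
- by rewrite ler0n.
- move=> x x'; have [r -> /andP[r1 r2]] := dist_gdist (ptP x) (ptP x').
  have [s -> /andP[s1 s2]] := distT _ _ _ _ (fP x) (fP x').
  have up : (gdist t (F (pt x)) (F (pt x')) <= d (pt x) (pt x'))%N.
    have [p px [pl <-]] := gdist_walk adj_conn (pt x) (pt x').
    have [q [qt ql qs]] := to_layer_tree_path o adj_sym adj_conn px.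
    by apply: leq_trans qs; apply: (gdist_min t_conn); exists q; rewrite // ql pl.
  have lo : (d (pt x) (pt x') <= D.+1 * gdist t (F (pt x)) (F (pt x')) + 2 * D)%N.
    have [q qt [ql <-]] := gdist_walk t_conn (F (pt x)) (F (pt x')).
    have := layer_path_gdist adj_sym adj_conn clD qt; rewrite ql /=.
    have := gdist_cluster_rep clD (pt x).
    have := gdist_cluster_rep clD (pt x').
    have := gdist_tri adj_conn (cluster_rep adj o (pt x)) (pt x) (pt x').
    have := gdist_tri adj_conn (cluster_rep adj o (pt x')) (cluster_rep adj o (pt x)) (pt x').
    rewrite (gdistC adj_sym adj_conn (cluster_rep adj o (pt x')) (pt x')).
    by move: (D.+1 * _)%N; lia.
  move: up lo; rewrite -!(ler_nat R) natrD !natrM -natr1.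
  move: (gdist t _ _) (d _ _) s1 s2 r1 r2 => m n s1 s2 r1 r2 up lo.
  have D0 : 0 <= D%:R :> R by [].
  have n0 : 0 <= n%:R :> R by [].
  (* The comparison with the graph distance only yields [-2 <= r], hence the shift. *)
  have Dr : 0 <= D%:R * (r + 2) by apply: mulr_ge0 => //; lra.
  have Ds : 0 <= D%:R * (s + 2 - m%:R) by apply: mulr_ge0 => //; lra.
  rewrite -EFinM -EFinB -EFinM -EFinD !lee_fin; apply/andP; split; last first.
    by rewrite natrD natrM; lra.
  rewrite lerBlDr mulrC ler_pdivrMr ?natr1 ?ltr0n // -natr1 natrD natrM; nra.
- move=> y; have [A yA] := near_vertex_ex ts y.
  exists (vpt R i_vert (val A)).
  have e : F (pt (vpt R i_vert (val A))) = A.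
    rewrite (near_vertex_vpt i_inj (ptP (vpt R i_vert (val A)))).
    exact: to_layer_treeK.
  have [s -> /andP[_ s2]] := distT _ _ _ _ (fP (vpt R i_vert (val A))) yA.
  rewrite e gdistxx // in s2.
  by rewrite lee_fin (le_trans s2) // natrD natrM; have : 0 <= D%:R :> R by []; lra.
Qed.

End QuasiTree.

(** * Windings in right-angled Artin groups *)

Section GroupFacts.
Local Open Scope group_scope.

Lemma conjg_commute (H : groupType) (x y : H) : commute x y -> x ^ y = x.
Proof. by move=> xy; rewrite conjgE xy mulKg. Qed.

Lemma commute_conjg (H : groupType) (x y : H) : x ^ y = x -> commute x y.
Proof. by move=> xy; rewrite /commute conjgC xy. Qed.

End GroupFacts.

Section Winding.
Local Open Scope group_scope.
Variables (V : finType) (e : rel V).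
Local Notation G := (raag e).
Local Notation ev := (@raag_of_word V e).
Local Notation gen := (@raag_gen V e).

Definition letter (x : V * bool) : G := if x.2 then (gen x.1)^-1 else gen x.1.

Lemma raag_of_word_cat u w : ev (u ++ w) = ev u * ev w.
Proof. exact/esym/raag_mulE. Qed.

Lemma raag_of_word_nil : ev [::] = 1.
Proof. by []. Qed.

Lemma raag_of_word_cons x w : ev (x :: w) = letter x * ev w.
Proof.
rewrite -cat1s raag_of_word_cat; congr (_ * _); case: x => v [] //.
by rewrite /letter /raag_gen -[RHS]/(raag_inv _) raag_invE.
Qed.

Definition word_of_raag (g : G) : word V := generic_quotient.repr g.

Lemma word_of_raagK g : ev (word_of_raag g) = g.
Proof. exact: raag_of_wordK. Qed.

Lemma gen_commute u v : e u v -> commute (gen u) (gen v).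
Proof.
move=> uv; rewrite /commute -!raag_of_word_cat; apply/raag_of_wordP.
exact: (RaagComm [::] [::] uv).
Qed.

Lemma gen_conj_letter v b : gen v ^ letter (v, b) = gen v.
Proof. by case: b; rewrite /letter /= conjgE ?invgK ?mulgV ?mulg1 ?mulKg. Qed.

(** The conjugates of generators crossed by the path spelled by a word from
    [1], with the direction of the crossing: a prefix [p] followed by [v] or
    its inverse crosses [p v p^-1]. *)
Fixpoint crossings (w : word V) : seq (G * bool) :=
  if w is x :: w' then
    (gen x.1, x.2) :: [seq (y.1 ^ (letter x)^-1, y.2) | y <- crossings w']
  else [::].

Lemma crossings_cat u w :
  crossings (u ++ w) = crossings u ++ [seq (y.1 ^ (ev u)^-1, y.2) | y <- crossings w].
Proof.
elim: u => [|x u ih] /=.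
  rewrite raag_of_word_nil -[LHS]map_id; apply: eq_map => -[t b] /=.
  by rewrite invg1 conjg1.
rewrite ih map_cat -map_comp; congr (_ :: _ ++ _); apply: eq_map => -[t b] /=.
by rewrite raag_of_word_cons invgM conjgM.
Qed.

Lemma crossings_split w t b : (t, b) \in crossings w ->
  exists w1 v w2, w = w1 ++ (v, b) :: w2 /\ t = gen v ^ (ev w1)^-1.
Proof.
elim: w t => [|[v c] w ih] t //=; rewrite inE => /orP[/eqP[-> ->]|].
  by exists [::], v, w; rewrite raag_of_word_nil invg1 conjg1.
move=> /mapP[[t' b'] /= tw [-> bb']]; rewrite -bb' in tw.
have [w1 [u [w2 [-> ->]]]] := ih _ tw; exists ((v, c) :: w1), u, w2.
by rewrite raag_of_word_cons invgM conjgM.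
Qed.

Local Open Scope ring_scope.
Definition winding_word (w : word V) (t : G) : int :=
  \sum_(y <- crossings w | y.1 == t) (-1) ^+ y.2.
Local Close Scope ring_scope.

Lemma winding_word_cat u w t : (winding_word (u ++ w) t =
  winding_word u t + winding_word w (t ^ ev u)%g)%R.
Proof.
rewrite /winding_word crossings_cat big_cat big_map /=; congr (_ + _)%R.
apply: eq_bigl => y; apply/eqP/eqP => [<-|->]; first by rewrite conjgKV.
by rewrite conjgK.
Qed.

(** A cancelling pair crosses the same conjugate in opposite directions, and two commuting letters
    cross the same two conjugates in either order. *)
Lemma winding_word_eq u w t : raag_eq e u w -> winding_word u t = winding_word w t.
Proof.
move=> uw; elim: uw t => {u w} [w|u w _ ih|u w z _ ih1 _ ih2|u w v b|w1 w2 u v uv] t //.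
- by rewrite ih1 ih2.
- rewrite !winding_word_cat; congr (_ + _)%R.
  have -> : ev [:: (v, b); (v, ~~ b)] = 1.
    by apply/raag_of_wordP; apply: (RaagCancel e [::] [::]).
  rewrite conjg1 -[RHS]add0r; congr (_ + _)%R.
  rewrite /winding_word /= !big_cons big_nil /=.
  have -> : gen v ^ (letter (v, b))^-1 = gen v.
    by rewrite -{1}(gen_conj_letter v b) conjgK.
  by case: eqP => _ //; case: b.
- rewrite !winding_word_cat; congr (_ + _)%R.
  have uvE : ev [:: (u, false); (v, false)] = ev [:: (v, false); (u, false)].
    by rewrite !(raag_of_word_cons, raag_of_word_nil) !mulg1; apply: gen_commute.
  rewrite uvE; congr (_ + _)%R; rewrite /winding_word /= !big_cons big_nil /=.
  have c x y : commute (gen x) (gen y) -> gen x ^ (letter (y, false))^-1 = gen x.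
    by move=> xy; rewrite /letter /= conjgE invgK mulgA -xy mulgK.
  rewrite !c; [|exact: gen_commute|exact/commute_sym/gen_commute].
  by do 2!case: ifP => _; rewrite ?addr0 ?add0r.
Qed.

Definition winding (g : G) (t : G) : int := winding_word (word_of_raag g) t.

Lemma winding_of_word w t : winding (ev w) t = winding_word w t.
Proof. by apply/winding_word_eq/raag_of_wordP/word_of_raagK. Qed.

(** This is the cocycle rule: [winding] is a crossed homomorphism into the integer functions on the
    group. *)
Lemma windingM g h t : (winding (g * h)%g t = winding g t + winding h (t ^ g)%g)%R.
Proof.
rewrite -(word_of_raagK g) -(word_of_raagK h) -raag_of_word_cat !winding_of_word.
exact: winding_word_cat.
Qed.

Lemma winding1 t : winding 1 t = 0%R.
Proof. by rewrite -raag_of_word_nil winding_of_word /winding_word big_nil. Qed.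

Lemma windingV g t : (winding g^-1%g t = - winding g (t ^ g^-1)%g)%R.
Proof.
have := windingM g g^-1 (t ^ g^-1); rewrite mulgV winding1 conjgKV => h.
by apply/eqP; rewrite -addr_eq0 addrC -h.
Qed.

Lemma winding_gen v t : winding (gen v) t = Posz (gen v == t).
Proof.
rewrite winding_of_word /winding_word /= big_cons big_nil /=.
by case: ifP => _ //; rewrite addr0.
Qed.

Lemma winding_crossing w t : winding (ev w) t <> 0%R ->
  exists b, (t, b) \in crossings w.
Proof.
rewrite winding_of_word /winding_word => h.
case: (boolP (has (fun y => y.1 == t) (crossings w))) => [/hasP[[t' b] yw /= /eqP tt']|].
  by exists b; rewrite -tt'.
move=> /hasPn hn; case: h; rewrite big1_seq // => y /andP[yt yw].
by have := hn _ yw; rewrite yt.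
Qed.

(** Conjugation leaves the winding about an axis commuting with the result
    unchanged: the contributions of [g] and [g^-1] cancel. *)
Lemma winding_conj g y t : commute t (y ^ g^-1) ->
  winding (y ^ g^-1) t = winding y (t ^ g).
Proof.
move=> tz; rewrite conjgE invgK mulgA !windingM windingV.
have -> : (t ^ (g * y)) ^ g^-1 = t.
  rewrite -conjgM; have -> : g * y * g^-1 = y ^ g^-1 by rewrite conjgE invgK mulgA.
  by rewrite conjgE tz mulKg.
by rewrite addrAC subrr add0r.
Qed.

(** A deletion condition as in Coxeter groups: if the first letter and a later letter [u] cross the
    same conjugate in opposite directions, the subword [w1] between them satisfies
    [gen v * ev w1 = ev w1 * gen u], so both letters can be erased. *)
Lemma shorten_head v c w t : gen v = t ^ (letter (v, c))^-1 ->
  (t, ~~ c) \in crossings w ->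
  exists w', [/\ ev w' = ev ((v, c) :: w), size w' < (size w).+1
    & {subset w' <= (v, c) :: w}].
Proof.
move=> vt /crossings_split[w1 [u [w2 [-> tE]]]]; exists (w1 ++ w2); split.
- rewrite raag_of_word_cons !raag_of_word_cat raag_of_word_cons !mulgA.
  congr (_ * _).
  have {}vt : gen v = gen u ^ (ev w1)^-1.
    by rewrite -tE -(gen_conj_letter v c) vt conjgKV.
  have vw : gen v * ev w1 = ev w1 * gen u.
    by rewrite vt conjgE invgK -!mulgA mulVg mulg1.
  rewrite /letter; case: (c) => /=.
    by rewrite -mulgA -vw mulKg.
  by rewrite vw mulgK.
- by rewrite !size_cat /= addnS ltnS leqnSn.
- by move=> x; rewrite !inE !mem_cat inE => /orP[] ->; rewrite !orbT.
Qed.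

Lemma shorten w t b : (t, b) \in crossings w -> (t, ~~ b) \in crossings w ->
  exists w', [/\ ev w' = ev w, size w' < size w & {subset w' <= w}].
Proof.
elim: w t => [|[v c] w ih] t //=; rewrite !inE.
move=> /orP[/eqP[-> ->]|/mapP[[t1 b1] /= tw1 [tE1 bE1]]];
  move=> /orP[/eqP[] |/mapP[[t2 b2] /= tw2 [tE2 bE2]]].
- by case: c.
- by apply: shorten_head tE2 _; rewrite bE2.
- move=> tv cb; apply: (@shorten_head v c w t1); first by rewrite -tE1.
  by rewrite -cb negbK bE1.
- have e12 : t1 = t2 by apply: (conjg_inj (letter (v, c))^-1); rewrite -tE1.
  rewrite -{}bE1 in tw1; rewrite -{}bE2 -{}e12 in tw2.
  have [w' [ww' sw' sub]] := ih _ tw1 tw2; exists ((v, c) :: w'); split => //.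
    by rewrite !raag_of_word_cons ww'.
  by move=> x; rewrite !inE => /orP[->//|/sub ->]; rewrite orbT.
Qed.

Lemma reduced_word w : exists w', [/\ ev w' = ev w, {subset w' <= w}
  & forall y, y \in crossings w' -> winding (ev w) y.1 <> 0%R].
Proof.
have [n] := ubnP (size w); elim: n w => // n ih w wn.
case: (pselect (exists t b, (t, b) \in crossings w /\ (t, ~~ b) \in crossings w)).
  move=> [t [b [h1 h2]]]; have [w1 [ww1 sw1 sub1]] := shorten h1 h2.
  have [|w2 [ww2 sub2 h]] := ih w1; first exact: leq_trans sw1 _.
  exists w2; rewrite ww2 ww1; split => //; first by move=> x /sub2/sub1.
  by rewrite -ww1.
move=> hn; exists w; split => // -[t b] tw; rewrite winding_of_word /winding_word /=.
(* All crossings of [t] now have the same sign, so the winding is, up to sign, their number. *)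
have -> : (\sum_(y <- crossings w | y.1 == t) (-1) ^+ y.2 =
    \sum_(y <- crossings w | y.1 == t) (-1) ^+ b :> int)%R.
  rewrite [LHS]big_mkcond [RHS]big_mkcond; apply: eq_big_seq => -[t' b'] /= yw.
  case: eqP => // tt'; subst t'; case: (eqVneq b' b) => [->//|bb'].
  case: hn; exists t, b; split => //.
  by have -> : ~~ b = b' by case: (b) (b') bb' => [] [].
rewrite big_const_seq iter_addr_0 => /eqP; rewrite mulrn_eq0 signr_eq0 orbF.
by rewrite -leqn0 leqNgt -has_count => /hasP[]; exists (t, b).
Qed.

Lemma commute_word g w : (forall x, x \in w -> commute g (gen x.1)) -> commute g (ev w).
Proof.
elim: w => [|[v b] w ih] h; first by rewrite raag_of_word_nil; apply: commute1.
rewrite raag_of_word_cons; apply: commuteM.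
  by have := h _ (mem_head _ _); rewrite /letter /=; case: b {h} => //; apply: commuteV.
by apply: ih => x xw; apply: h; rewrite inE xw orbT.
Qed.

Lemma crossings_commuting w :
  {in w &, forall x y, commute (gen x.1) (gen y.1)} ->
  forall y, y \in crossings w -> exists2 x, x \in w & y.1 = gen x.1.
Proof.
move=> cw [t b] /crossings_split[w1 [v [w2 [wE ->]]]].
have vw : (v, b) \in w by rewrite wE mem_cat mem_head orbT.
exists (v, b) => //=; apply: conjg_commute; apply/commuteV/commute_word => x xw1.
by apply: (cw (v, b) x vw); rewrite wE mem_cat xw1.
Qed.

Lemma raag_of_word_nseq n v : ev (nseq n (v, false)) = gen v ^+ n.
Proof.
elim: n => [|n ih]; first by rewrite raag_of_word_nil expg0.
by rewrite [nseq _ _]/= raag_of_word_cons ih expgS.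
Qed.

Lemma winding_expg v n : winding (gen v ^+ n) (gen v) = Posz n.
Proof.
elim: n => [|n ih]; first by rewrite expg0 winding1.
rewrite expgS windingM winding_gen eqxx conjg_commute ?ih //; exact: commute_refl.
Qed.

(** The power [z] is fixed by conjugation by [g], so its winding about [gen v ^ g^-1] equals the one
    about [gen v], which is [n.+1]. But the word spelling [z] crosses only [gen v]. *)
Lemma commute_root g v n : commute g (gen v ^+ n.+1) -> commute g (gen v).
Proof.
move=> gz; set z := gen v ^+ n.+1 in gz.
have zg : z ^ g^-1 = z by apply/conjg_commute/commuteV/commute_sym.
have tz : commute (gen v ^ g^-1) z.
  rewrite /commute -{1 2}zg -!conjMg; congr (_ ^ _).
  exact/commuteX/commute_refl.
have : winding z (gen v ^ g^-1) <> 0%R.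
  by rewrite -{1}zg winding_conj ?zg // conjgKV winding_expg.
rewrite {1}/z -raag_of_word_nseq => /winding_crossing[b].
move=> /crossings_commuting[|x]; first by move=> x y /nseqP[-> _] /nseqP[-> _].
move=> /nseqP[-> _] /= h; rewrite -[g]invgK.
exact/commute_sym/commuteV/commute_conjg.
Qed.

(** The support of the winding of [h] is finite and invariant under
    conjugation by [gen v], so a power of [gen v] commutes with [t]. *)
Lemma commute_winding h v t : commute h (gen v) -> winding h t <> 0%R ->
  commute t (gen v).
Proof.
move=> hv ht.
have inv s : winding h s = winding h (s ^ gen v).
  have := windingM h (gen v) s; rewrite hv windingM !winding_gen.
  have -> : (gen v == s ^ h) = (gen v == s).
    rewrite -{1}(conjg_commute (commute_sym hv)).
    by apply/eqP/eqP => [/conjg_inj|->].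
  by move=> E; apply: (@addrI _ (Posz (gen v == s))); rewrite E addrC.
have {}ht n : winding h (t ^ (gen v ^+ n)) <> 0%R.
  elim: n => [|n ih]; first by rewrite expg0 conjg1.
  by rewrite expgSr conjgM -inv.
pose s := [seq y.1 | y <- crossings (word_of_raag h)].
pose f n := t ^ (gen v ^+ n).
have fs n : f n \in s.
  have := ht n; rewrite -(word_of_raagK h) => /winding_crossing[b ys].
  by apply/mapP; exists (f n, b).
have /(uniqPn 1)[i [j [ij jn]]] : ~~ uniq (map f (iota 0 (size s).+1)).
  apply/negP => /uniq_leq_size h'; have := h' s.
  rewrite (size_map f) size_iota ltnn => h2; suff : false by [].
  by apply: h2 => _ /mapP[n _ ->].
rewrite (size_map f) size_iota in jn.
rewrite !(nth_map 0) ?size_iota ?(ltn_trans ij) // !nth_iota ?(ltn_trans ij) //.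
rewrite !add0n /f => E; apply/(@commute_root _ _ (j - i).-1).
rewrite prednK ?subn_gt0 //; apply/commute_conjg/(@conjg_inj _ (gen v ^+ i)).
by rewrite -conjgM -expgnDr subnK // ltnW.
Qed.

(** The first letter is itself crossed, so it commutes with [g]; conjugation by it then fixes [g]
    and carries the hypothesis over to the tail. *)
Lemma commuting_letters w g : (forall y, y \in crossings w -> commute y.1 g) ->
  forall x, x \in w -> commute (gen x.1) g.
Proof.
elim: w => [|x w ih] //= h z; rewrite inE => /orP[/eqP ->|zw].
  exact: (h (gen x.1, x.2) (mem_head _ _)).
apply: ih zw => y yw.
have xg : commute (gen x.1) g by apply: (h (gen x.1, x.2) (mem_head _ _)).
have lg : g ^ (letter x)^-1 = g.
  apply/conjg_commute/commuteV; rewrite /letter; case: x.2; first apply: commuteV;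
    exact: commute_sym.
have := h (y.1 ^ (letter x)^-1, y.2); rewrite inE => /(_ _) c.
have {}c : commute (y.1 ^ (letter x)^-1) g.
  by apply: c; apply/orP; right; apply/mapP; exists y.
apply: (@conjg_inj _ (letter x)^-1); rewrite !conjMg lg; exact: c.
Qed.

(** The centralizer of a generator is generated by its star: every crossing of a reduced word for
    [h] has nonzero winding, hence commutes with [gen v]. *)
Lemma centralizer_gen h v : commute h (gen v) -> exists w,
  ev w = h /\ forall x, x \in w -> commute (gen x.1) (gen v).
Proof.
move=> hv; have [w [wh _ wr]] := reduced_word (word_of_raag h).
rewrite word_of_raagK in wh wr; exists w; split => //.
apply: commuting_letters => y yw; exact: commute_winding hv (wr _ yw).
Qed.

(** * Homomorphisms to other groups and detection of generators *)

Section Lift.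
Variables (H : groupType) (phi : V -> H).
Hypothesis phi_commute : forall u v, e u v -> commute (phi u) (phi v).

Definition lift_word (w : word V) : H :=
  foldr (fun x h => (if x.2 then (phi x.1)^-1 else phi x.1) * h) 1 w.

Lemma lift_word_cat u w : lift_word (u ++ w) = lift_word u * lift_word w.
Proof. by elim: u => [|x u ih] /=; rewrite ?mul1g // ih mulgA. Qed.

Lemma lift_word_eq u w : raag_eq e u w -> lift_word u = lift_word w.
Proof.
elim=> {u w} [w|u w _ ->|u w z _ -> _ ->|u w v b|w1 w2 u v uv] //.
- rewrite !lift_word_cat; congr (_ * _); rewrite /= mulg1.
  by case: b; rewrite /= ?mulVg ?mulgV mul1g.
- by rewrite !lift_word_cat /= !mulg1 phi_commute.
Qed.

Definition raag_lift (g : G) : H := lift_word (word_of_raag g).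

Lemma raag_lift_word w : raag_lift (ev w) = lift_word w.
Proof. by apply/lift_word_eq/raag_of_wordP/word_of_raagK. Qed.

Lemma raag_liftM g h : raag_lift (g * h) = raag_lift g * raag_lift h.
Proof.
rewrite -(word_of_raagK g) -(word_of_raagK h) -raag_of_word_cat !raag_lift_word.
exact: lift_word_cat.
Qed.

Lemma raag_lift_gen v : raag_lift (gen v) = phi v.
Proof. by rewrite raag_lift_word /= mulg1. Qed.

Lemma raag_liftV g : raag_lift g^-1 = (raag_lift g)^-1.
Proof.
apply: (mulgI (raag_lift g)); rewrite -raag_liftM !mulgV.
by rewrite -raag_of_word_nil raag_lift_word.
Qed.

Lemma raag_liftJ g h : raag_lift (g ^ h) = raag_lift g ^ raag_lift h.
Proof. by rewrite !conjgE !raag_liftM raag_liftV. Qed.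

End Lift.

(** One transposition of three points suffices to detect a generator; two noncommuting ones detect a
    pair of nonadjacent generators. *)
Let swap01 : {perm 'I_3} := tperm (inord 0) (inord 1).
Let swap12 : {perm 'I_3} := tperm (inord 1) (inord 2).

Let swap_neq1 : swap01 != 1.
Proof.
apply/eqP => /permP/(_ (inord 0)); rewrite /swap01 tpermL perm1 => /(congr1 val) /=.
by rewrite !inordK.
Qed.

Let swap_noncommuting : ~ commute swap01 swap12.
Proof.
have fix0 : swap12 (inord 0) = inord 0.
  by apply: tpermD; apply/eqP => /(congr1 val) /=; rewrite !inordK.
move=> /permP/(_ (inord 0)); rewrite !permM fix0 /swap01 /swap12 !tpermL.
by move=> /(congr1 val) /=; rewrite !inordK.
Qed.

Let indicator (v u : V) : {perm 'I_3} := if u == v then swap01 else 1.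

Let indicator_commute v u u' : e u u' -> commute (indicator v u) (indicator v u').
Proof.
move=> _; rewrite /indicator; case: ifP => _; case: ifP => _ //.
- exact: commute1.
- exact/commute_sym/commute1.
Qed.

Lemma conj_gen_inj u v g h : gen u ^ g = gen v ^ h -> u = v.
Proof.
move=> E; case: (eqVneq v u) => // vu.
have := congr1 (raag_lift (indicator u)) E.
rewrite !(raag_liftJ (@indicator_commute u)) !(raag_lift_gen (@indicator_commute u)).
rewrite /indicator eqxx (negPf vu) conj1g => /eqP.
by rewrite conjg_eq1 (negPf swap_neq1).
Qed.

Lemma gen_of_word u w : gen u = ev w -> exists b, (u, b) \in w.
Proof.
move=> E; have := congr1 (raag_lift (indicator u)) E.
rewrite (raag_lift_gen (@indicator_commute u)) (raag_lift_word (@indicator_commute u)).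
case: (boolP (has (fun x => x.1 == u) w)) => [/hasP[[v b] vw /= /eqP <-]|/hasPn h].
  by exists b.
have -> : lift_word (indicator u) w = 1.
  elim: w h {E} => [|x w ih] //= h.
  rewrite ih => [|y yw]; last by apply: h; rewrite inE yw orbT.
  by rewrite /indicator (negPf (h x (mem_head _ _))) invg1 if_same mulg1.
by rewrite /indicator eqxx => /eqP; rewrite (negPf swap_neq1).
Qed.

Hypothesis e_sym : symmetric e.

Lemma gen_commuteP u v : commute (gen u) (gen v) -> u = v \/ e u v.
Proof.
move=> uv; case: (eqVneq u v) => [->|nuv]; [by left|right].
case: (boolP (e u v)) => // euv.
(* As [u] and [v] are not adjacent, no defining relation asks their images to commute. *)
pose phi w : {perm 'I_3} := if w == u then swap01 else if w == v then swap12 else 1.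
have c x y : e x y -> commute (phi x) (phi y).
  rewrite /phi; case: (eqVneq x u) => [->|xu]; case: (eqVneq y u) => [->|yu] //.
  - by case: eqP => [-> euv'|_ _]; [rewrite euv' in euv|apply: commute1].
  - by case: eqP => [->|_ _]; [rewrite e_sym (negPf euv)|apply/commute_sym/commute1].
  - by do 2!case: eqP => _; move=> _; do ?[exact: commute1|exact/commute_sym/commute1].
have := congr1 (raag_lift phi) uv; rewrite !(raag_liftM c) !(raag_lift_gen c).
by rewrite /phi !eqxx eq_sym (negPf nuv) => /swap_noncommuting.
Qed.

End Winding.

(** * Flats and the coset intersection complex *)

Section StandardSubgroups.
Local Open Scope classical_set_scope.
Local Open Scope group_scope.
Variables (V : finType) (e : rel V).
Local Notation G := (raag e).
Local Notation ev := (@raag_of_word V e).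
Local Notation gen := (@raag_gen V e).

Lemma subgroup_gen_is_subgroup (H : groupType) (S : set H) :
  is_subgroup (subgroup_gen S).
Proof.
split; first by rewrite inE => A [[A1 _] _]; rewrite inE in A1.
move=> x y /[!inE] Sx Sy A [Agrp SA]; have [_ Adiv] := Agrp.
have := Adiv x y; rewrite !inE; apply; [exact: Sx|exact: Sy].
Qed.

Lemma is_subgroup1 (H : groupType) (A : set H) : is_subgroup A -> A 1.
Proof. by case; rewrite inE. Qed.

Lemma is_subgroupV (H : groupType) (A : set H) x : is_subgroup A -> A x -> A x^-1.
Proof. by move=> /group_closedV/(_ x); rewrite !inE. Qed.

Lemma is_subgroupM (H : groupType) (A : set H) x y :
  is_subgroup A -> A x -> A y -> A (x * y).
Proof. by move=> /group_closedM/(_ x y); rewrite !inE. Qed.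

Lemma subgroup_gen_words (A : set V) :
  subgroup_gen (gen @` A) =
  [set ev w | w in [set w : seq (V * bool) | forall x, x \in w -> A x.1]].
Proof.
apply/seteqP; split.
  apply: smallest_sub; last first.
    move=> _ [v Av <-]; exists [:: (v, false)] => // x.
    by rewrite inE => /eqP ->.
  split; first by rewrite inE; exists [::].
  move=> x y /[!inE] -[u uA <-] [w wA <-]; exists (u ++ inv_word w).
    move=> z; rewrite mem_cat /inv_word mem_rev => /orP[/uA//|/mapP[t /wA At ->]].
    exact: At.
  by rewrite raag_of_word_cat -raag_invE.
move=> _ [w wA <-]; have Hgrp := subgroup_gen_is_subgroup (gen @` A).
elim: w wA => [|x w ih] wA; first exact: is_subgroup1 Hgrp.
rewrite raag_of_word_cons; apply: (is_subgroupM Hgrp); last first.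
  by apply: ih => y yw; apply: wA; rewrite inE yw orbT.
have Sx : subgroup_gen (gen @` A) (gen x.1).
  by apply: sub_gen_smallest; exists x.1 => //; apply: (wA x (mem_head _ _)).
by rewrite /letter; case: x.2 => //; apply: (is_subgroupV Hgrp).
Qed.

Definition edge_group (a b : V) : set G := subgroup_gen (gen @` [set a; b]).

Lemma edge_groupP a b z : edge_group a b z <->
  exists w, ev w = z /\ forall x, x \in w -> x.1 = a \/ x.1 = b.
Proof.
rewrite /edge_group subgroup_gen_words; split=> [[w wA <-]|[w [<- wA]]].
  by exists w; split.
by exists w.
Qed.

Lemma edge_groupC a b : edge_group a b = edge_group b a.
Proof. by rewrite /edge_group setUC. Qed.

Lemma edge_group_is_subgroup a b : is_subgroup (edge_group a b).
Proof. exact: subgroup_gen_is_subgroup. Qed.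

Lemma edge_group_gen a b : edge_group a b (gen a).
Proof.
apply/edge_groupP; exists [:: (a, false)]; split => // x.
by rewrite inE => /eqP ->; left.
Qed.

Lemma gen_edge_group a b c : edge_group a b (gen c) -> c = a \/ c = b.
Proof.
move=> /edge_groupP[w [wc wA]].
by have [b' cw] := gen_of_word (esym wc); apply: (wA _ cw).
Qed.

Lemma edge_letters_commute a b (x y : V) : e a b -> (x = a \/ x = b) ->
  (y = a \/ y = b) -> commute (gen x) (gen y).
Proof.
move=> ab [->|->] [->|->]; do ?[exact: commute_refl|exact: gen_commute].
exact/commute_sym/gen_commute.
Qed.

Lemma edge_group_commute_gen a b z : e a b -> edge_group a b z -> commute z (gen a).
Proof.
move=> ab /edge_groupP[w [<- wA]]; apply/commute_sym/commute_word => x /wA xab.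
by apply: (edge_letters_commute ab) => //; left.
Qed.

Lemma winding_edge_group a b z t : e a b -> edge_group a b z ->
  winding z t <> 0%R -> t = gen a \/ t = gen b.
Proof.
move=> ab /edge_groupP[w [<- wA]] /winding_crossing[c].
move=> /crossings_commuting[x y /wA xA /wA yA|x /wA xA /= ->].
  exact: edge_letters_commute ab xA yA.
by case: xA => ->; [left|right].
Qed.

Lemma edge_group_neq1 a b z : e a b -> edge_group a b z -> z <> 1 ->
  exists2 t, t = gen a \/ t = gen b & winding z t <> 0%R.
Proof.
move=> ab zab z1; have := zab => /edge_groupP[w [wz wA]].
have [w' [ww' _ wr]] := reduced_word e w; rewrite wz in ww' wr.
case: w' ww' wr => [|x w'] ww' wr; first by case: z1.
have h := wr _ (mem_head _ _); exists (gen x.1) => //.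
exact: winding_edge_group h.
Qed.

Hypothesis e_sym : symmetric e.
Hypotheses (V_inh : inhabited V) (e_tri : triangle_free e).
Hypothesis e_val : forall v : V, 2 <= valence e v.

Definition neighbour (v : V) : V := odflt v [pick w | e v w].

Lemma neighbourP v : e v (neighbour v).
Proof.
rewrite /neighbour; case: pickP => //= h.
by have := e_val v; rewrite /valence eq_card0.
Qed.

(** A third vertex adjacent to both ends of the edge would form a triangle. *)
Lemma commute_edge a b c : e a b -> commute (gen c) (gen a) ->
  commute (gen c) (gen b) -> c = a \/ c = b.
Proof.
move=> ab /(gen_commuteP e_sym)[->|ca]; first by left.
move=> /(gen_commuteP e_sym)[->|cb]; first by right.
by have := e_tri ca ab; rewrite cb.
Qed.

Lemma centralizer_edge a b h : e a b -> commute h (gen a) -> commute h (gen b) ->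
  edge_group a b h.
Proof.
move=> ab ha hb; have [w [wh _ wr]] := reduced_word e (word_of_raag h).
rewrite word_of_raagK in wh wr; apply/edge_groupP; exists w; split => // x xw.
apply: (commute_edge ab).
- by apply: (commuting_letters (w := w)) => // y yw; apply: commute_winding ha (wr _ yw).
- by apply: (commuting_letters (w := w)) => // y yw; apply: commute_winding hb (wr _ yw).
Qed.

Lemma subgroup_gen_mono (A B : set V) : A `<=` B ->
  subgroup_gen (gen @` A) `<=` subgroup_gen (gen @` B).
Proof.
move=> AB; apply: sub_smallest2r; first exact: subgroup_gen_is_subgroup.
exact: image_subset.
Qed.

Lemma edge_group_abelian a b : e a b -> abelian_set (edge_group a b).
Proof.
move=> ab x y xA yA; apply/commute_sym; move: xA => /edge_groupP[w [<- wA]].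
apply: commute_word => z /wA[]->; first exact: edge_group_commute_gen yA.
apply: (edge_group_commute_gen (a := b) (b := a)); first by rewrite e_sym.
by rewrite edge_groupC.
Qed.

Lemma maximal_standard_abelianP (P : set G) :
  @maximal_standard_abelian V e P <-> exists a b, e a b /\ P = edge_group a b.
Proof.
split=> [[[A ->] Aab Amax]|[a [b [ab ->]]]].
  have AA c : A c -> subgroup_gen (gen @` A) (gen c).
    by move=> Ac; apply: sub_gen_smallest; exists c.
  (* Distinct commuting generators are adjacent, so without triangles [A] has at most two elements;
     a smaller [A] is completed to an edge by a neighbour. *)
  have [a [b [ab Asub]]] : exists a b, e a b /\ A `<=` [set a; b].
    case: (pselect (exists a, A a)) => [[a Aa]|A0]; last first.
      have [v] := V_inh; exists v, (neighbour v); split; first exact: neighbourP.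
      by move=> c Ac; case: A0; exists c.
    case: (pselect (exists2 b, A b & b <> a)) => [[b Ab ba]|A1]; last first.
      exists a, (neighbour a); split; first exact: neighbourP.
      by move=> c Ac; left; apply: contrapT => ca; apply: A1; exists c.
    have ab : e a b.
      have /(gen_commuteP e_sym)[/esym //|//] := Aab _ _ (AA _ Aa) (AA _ Ab).
    exists a, b; split => // c Ac; apply: (commute_edge ab); apply: Aab; exact: AA.
  exists a, b; split => //; apply/esym/Amax; last exact: subgroup_gen_mono.
    by exists [set a; b].
  exact: edge_group_abelian.
split; [by exists [set a; b]|exact: edge_group_abelian|].
move=> _ [A ->] Aab sub; apply/seteqP; split => //; apply: subgroup_gen_mono => c Ac.
have Sc : subgroup_gen (gen @` A) (gen c) by apply: sub_gen_smallest; exists c.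
apply: (commute_edge ab); apply: Aab => //; apply: sub; first exact: edge_group_gen.
by rewrite edge_groupC; apply: edge_group_gen.
Qed.

End StandardSubgroups.

(** * Axes of flats, the graph of flats and its bottlenecks *)

Section Flats.
Local Open Scope classical_set_scope.
Local Open Scope group_scope.
Variables (V : finType) (e : rel V).
Hypothesis e_sym : symmetric e.
Hypotheses (e_conn : connected_graph e) (e_tri : triangle_free e).
Hypothesis e_val : forall v : V, 2 <= valence e v.
Local Notation G := (raag e).
Local Notation ev := (@raag_of_word V e).
Local Notation gen := (@raag_gen V e).
Local Notation edge_group := (@edge_group V e).
Local Notation MSA := (@maximal_standard_abelian V e).

Let V_inh : inhabited V := proj1 e_conn.

Definition flat (g : G) (a b : V) : set G := left_coset g (edge_group a b).

Lemma flatP g a b h : flat g a b h <-> edge_group a b (g^-1 * h).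
Proof.
split=> [[x xA <-]|h']; first by rewrite mulKg.
by exists (g^-1 * h); rewrite // mulVKg.
Qed.

Lemma flat_mem g a b : flat g a b g.
Proof.
by apply/flatP; rewrite mulVg; apply: is_subgroup1 (edge_group_is_subgroup _ _ _).
Qed.

Lemma flat_shift g a b h : flat g a b h -> flat h a b = flat g a b.
Proof.
move=> /flatP gh; have S := edge_group_is_subgroup e a b.
apply/seteqP; split=> x /flatP hx; apply/flatP.
  have -> : g^-1 * x = (g^-1 * h) * (h^-1 * x) by rewrite mulgA mulgK.
  exact: is_subgroupM S gh hx.
have -> : h^-1 * x = (g^-1 * h)^-1 * (g^-1 * x) by rewrite invgM invgK mulgA mulgK.
exact: is_subgroupM S (is_subgroupV S gh) hx.
Qed.

Lemma flatC g a b : flat g a b = flat g b a.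
Proof. by rewrite /flat edge_groupC. Qed.

(** Left multiplication by [t] preserves the flat and translates it along the line [g <a>]. *)
Definition has_axis (t : G) (C : set G) : Prop := exists g a b,
  [/\ e a b, C = flat g a b & t = gen a ^ g^-1].

Lemma has_axis_flat g a b : e a b -> has_axis (gen a ^ g^-1) (flat g a b).
Proof. by exists g, a, b. Qed.

Lemma has_axis_flat_r g a b : e a b -> has_axis (gen b ^ g^-1) (flat g a b).
Proof. by move=> ab; exists g, b, a; split; rewrite 1?e_sym // flatC. Qed.

(** Moving the base point inside the flat leaves the conjugated generators unchanged, because the
    edge group is abelian. *)
Lemma has_axis_gens t g a b : e a b -> has_axis t (flat g a b) ->
  t = gen a ^ g^-1 \/ t = gen b ^ g^-1.
Proof.
move=> ab [h [c [d [cd E ->]]]].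
have gcd : flat h c d g by rewrite -E; apply: flat_mem.
have sub z : edge_group c d z -> edge_group a b z.
  rewrite -(flat_shift gcd) in E => zc.
  have : flat g c d (g * z) by apply/flatP; rewrite mulKg.
  by rewrite -E => /flatP; rewrite mulKg.
have -> : gen c ^ h^-1 = gen c ^ g^-1.
  have /flatP/(edge_group_commute_gen cd)/commute_sym/conjg_commute H := gcd.
  by apply: (@conjg_inj _ g); rewrite -conjgM H conjgKV.
have /sub/gen_edge_group[->|->] := @edge_group_gen V e c d; [by left|by right].
Qed.

(** Conjugate generators are equal, so [g^-1 * h] centralizes both generators of the edge and lies
    in the edge group. *)
Lemma flat_eq g h a b c d : e a b -> e c d -> gen a ^ g^-1 = gen c ^ h^-1 ->
  gen b ^ g^-1 = gen d ^ h^-1 -> flat g a b = flat h c d.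
Proof.
move=> ab cd ac bd; have ca := conj_gen_inj ac; have db := conj_gen_inj bd.
subst c d; apply/esym/flat_shift/flatP.
have E v : gen v ^ g^-1 = gen v ^ h^-1 -> commute (g^-1 * h) (gen v).
  by move=> H; apply/commute_sym/commute_conjg; rewrite conjgM H conjgKV.
by apply: centralizer_edge; auto.
Qed.

Lemma has_axis_uniq t t' C C' : t <> t' -> has_axis t C -> has_axis t' C ->
  has_axis t C' -> has_axis t' C' -> C = C'.
Proof.
move=> tt' [g [a [b [ab -> tg]]]] t'C [h [c [d [cd -> th]]]] t'C'.
apply: flat_eq => //; first by rewrite -tg.
case: (has_axis_gens ab t'C) => [E|<-]; first by case: tt'; rewrite E tg.
by case: (has_axis_gens cd t'C') => [E|<- //]; case: tt'; rewrite E th.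
Qed.

Lemma left_cosetsP C : left_cosets MSA C <-> exists g a b, e a b /\ C = flat g a b.
Proof.
split=> [[g [P [/(maximal_standard_abelianP e_sym V_inh e_tri e_val)]]]|].
  by move=> [a [b [ab ->]]] ->; exists g, a, b.
move=> [g [a [b [ab ->]]]]; exists g, (edge_group a b); split => //.
by apply/(maximal_standard_abelianP e_sym V_inh e_tri e_val); exists a, b.
Qed.

Lemma has_axis_left_cosets t C : has_axis t C -> left_cosets MSA C.
Proof. by move=> [g [a [b [ab -> _]]]]; apply/left_cosetsP; exists g, a, b. Qed.

Lemma conj_subgroupE (g : G) P z : conj_subgroup g P z <-> P (z ^ g).
Proof.
have E x : g * x * g^-1 = x ^ g^-1 by rewrite conjgE invgK mulgA.
split=> [[x Px <-]|Pz]; first by rewrite E conjgKV.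
by exists (z ^ g); rewrite // E conjgK.
Qed.

Lemma infinite_powers v g : infinite_set (range (fun n => (gen v ^ g) ^+ n)).
Proof.
move=> fin; apply: infinite_nat; apply: sub_finite_set (finite_preimage _ fin).
  by move=> n _; exists n.
move=> m n _ _; rewrite -!conjXg => /conjg_inj E.
by have := winding_expg e v m; rewrite E winding_expg => -[].
Qed.

(** An infinite intersection contains some [z] other than 1, which has nonzero winding about an axis
    [t] of one flat. Since [t] commutes with [z], this winding survives conjugation into the edge
    group of any other flat, where only the generators have nonzero winding; so [t] is an axis there
    too. Conversely, the powers of a common [t] are infinitely many elements of the intersection. *)
Lemma coset_simplexP (s : {fset set G}) : simplex (coset_intersection_complex MSA) s <->
  s != fset0 /\ exists t, forall C, C \in s -> has_axis t C.
Proof.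
split=> [[s0 sL sI]|[s0 [t st]]].
  split => //.
  have [z [zI z1]] : (coset_intersection MSA s `\` [set 1]) !=set0.
    exact/infinite_setN0/infinite_setD/finite_set1.
  have zC g a b : e a b -> flat g a b \in s -> edge_group a b (z ^ g).
    move=> ab Cs; apply/conj_subgroupE; apply: (zI (g, edge_group a b)); split => //=.
    by apply/(maximal_standard_abelianP e_sym V_inh e_tri e_val); exists a, b.
  have /fset0Pn[C0 C0s] := s0.
  have /left_cosetsP[g [a [b [ab C0E]]]] := sL _ C0s; rewrite C0E in C0s.
  have [|t0 t0E tz] := edge_group_neq1 ab (zC _ _ _ ab C0s).
    by move/eqP; rewrite conjg_eq1 => /eqP.
  exists (t0 ^ g^-1) => C Cs; have /left_cosetsP[h [c [d [cd CE]]]] := sL _ Cs.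
  rewrite CE in Cs *; have zh := zC _ _ _ cd Cs.
  have tz0 : commute t0 (z ^ g).
    have zg := zC _ _ _ ab C0s.
    case: t0E => ->; first exact/commute_sym/(edge_group_commute_gen ab).
    by apply/commute_sym/(@edge_group_commute_gen _ e b a); rewrite 1?e_sym // edge_groupC.
  have c1 : commute (t0 ^ g^-1) z.
    by rewrite -(conjgK g z) /commute -!conjMg; congr (_ ^ _).
  have : winding z (t0 ^ g^-1) <> 0%R.
    by rewrite -(conjgK g z) winding_conj ?conjgK // conjgKV.
  rewrite -(conjgK h z) winding_conj ?conjgK //.
  move=> /(winding_edge_group cd zh)[E|E].
    by exists h, c, d; split => //; rewrite -E conjgK.
  by exists h, d, c; split; rewrite 1?e_sym 1?flatC // -E conjgK.
split => //; first by move=> C /= /st/has_axis_left_cosets.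
have [v [g tE]] : exists v g, t = gen v ^ g.
  by have /fset0Pn[C /st[g [a [b [_ _ ->]]]]] := s0; exists a, g^-1.
apply: sub_infinite_set (@infinite_powers v g) => _ [n _ <-] [h P] [/= MP Ps].
have [c [d [cd PE]]] := (maximal_standard_abelianP e_sym V_inh e_tri e_val P).1 MP.
rewrite PE in Ps *; apply/conj_subgroupE; rewrite -tE.
have grp := edge_group_is_subgroup e c d.
have [x Sx ->] : exists2 x, edge_group c d x & t = x ^ h^-1.
  have [->|->] := has_axis_gens cd (st _ Ps); [exists (gen c)|exists (gen d)] => //.
    exact: edge_group_gen.
  by rewrite edge_groupC; apply: edge_group_gen.
rewrite conjXg conjgKV; elim: n => [|n ih]; first exact: is_subgroup1 grp.
by rewrite expgS; apply: (is_subgroupM grp).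
Qed.

Lemma coset_glue (s r : {fset set G}) C C' :
  simplex (coset_intersection_complex MSA) s ->
  simplex (coset_intersection_complex MSA) r -> C != C' ->
  C \in s -> C' \in s -> C \in r -> C' \in r ->
  simplex (coset_intersection_complex MSA) (s `|` r)%fset.
Proof.
move=> /coset_simplexP[s0 [t st]] /coset_simplexP[r0 [t' rt']] CC' Cs C's Cr C'r.
have tt' : t = t'.
  case: (pselect (t = t')) => // tt'.
  move/eqP: CC'; case; exact: has_axis_uniq tt' (st _ Cs) (rt' _ Cr) (st _ C's) (rt' _ C'r).
apply/coset_simplexP; split; first by apply/fset0Pn; exists C; rewrite in_fsetU Cs.
by exists t => D; rewrite in_fsetU => /orP[/st//|/rt']; rewrite tt'.
Qed.

Definition flat_vertex : choiceType := {C : set G | `[< left_cosets MSA C >]}.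

Lemma flat_left_cosets g a b : e a b -> `[< left_cosets MSA (flat g a b) >].
Proof. by move=> ab; apply/asboolP/left_cosetsP; exists g, a, b. Qed.

Definition mk_flat g a b (ab : e a b) : flat_vertex :=
  exist _ (flat g a b) (flat_left_cosets g ab).

Definition flat_adj : rel flat_vertex := fun x y =>
  (x != y) && `[< exists t, has_axis t (val x) /\ has_axis t (val y) >].

Lemma flat_vertexP (x : flat_vertex) g : val x g ->
  exists a b (ab : e a b), x = mk_flat g ab.
Proof.
have /asboolP/left_cosetsP[h [a [b [ab xE]]]] := valP x.
rewrite xE => hg; exists a, b, ab; apply: val_inj => /=.
by rewrite xE (flat_shift hg).
Qed.

Lemma flat_vertex_mem (x : flat_vertex) : exists g, val x g.
Proof.
have /asboolP/left_cosetsP[h [a [b [ab xE]]]] := valP x.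
by exists h; rewrite xE; apply: flat_mem.
Qed.

Lemma flat_vert (x : flat_vertex) :
  simplex (coset_intersection_complex MSA) [fset val x]%fset.
Proof.
have [g /flat_vertexP[a [b [ab ->]]]] := flat_vertex_mem x.
apply/coset_simplexP; split; first by apply/fset0Pn; exists (flat g a b); rewrite in_fset1.
by exists (gen a ^ g^-1) => C; rewrite in_fset1 => /eqP ->; apply: has_axis_flat.
Qed.

Lemma flat_surj C : simplex (coset_intersection_complex MSA) [fset C]%fset ->
  exists x : flat_vertex, val x = C.
Proof.
move=> /coset_simplexP[_ [t /(_ C)]]; rewrite in_fset1 eqxx => /(_ isT).
by move=> /has_axis_left_cosets/asboolP CL; exists (exist _ C CL).
Qed.

Lemma flat_adjP (x y : flat_vertex) : flat_adj x y <->
  x != y /\ simplex (coset_intersection_complex MSA) [fset val x; val y]%fset.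
Proof.
split=> [/andP[xy /asboolP[t [tx ty]]]|[xy /coset_simplexP[_ [t st]]]].
  split => //; apply/coset_simplexP; split.
    by apply/fset0Pn; exists (val x); rewrite !inE eqxx.
  by exists t => C; rewrite !inE => /orP[]/eqP ->.
by rewrite /flat_adj xy; apply/asboolP; exists t; split; apply: st; rewrite !inE eqxx ?orbT.
Qed.

Lemma flat_adj_sym : symmetric flat_adj.
Proof.
move=> x y; rewrite /flat_adj eq_sym; congr (_ && _).
by apply/asboolP/asboolP => -[t []]; exists t.
Qed.

Lemma walk_common_axis x y t : has_axis t (val x) -> has_axis t (val y) ->
  exists2 m, (m <= 1)%N & walk flat_adj x y m.
Proof.
move=> tx ty; case: (eqVneq x y) => [->|xy]; first by exists 0 => //; exists [::].
by exists 1%N => //; exists [:: y]; rewrite // /= andbT /flat_adj xy; apply/asboolP; exists t.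
Qed.

Lemma walk_flats_path g a b (ab : e a b) p : path e b p ->
  forall c d (cd : e c d), last b p = c -> exists2 m, (m <= (size p).+1)%N &
    walk flat_adj (mk_flat g ab) (mk_flat g cd) m.
Proof.
elim: p a b ab => [|v p ih] a b ab /=.
  move=> _ c d + bc; rewrite -bc => bd.
  by apply: (@walk_common_axis _ _ (gen b ^ g^-1));
    [exact: has_axis_flat_r|exact: has_axis_flat].
move=> /andP[bv vp] c d cd pc; have [m ms wm] := ih _ _ bv vp _ _ cd pc.
have [n n1 wn] := @walk_common_axis (mk_flat g ab) (mk_flat g bv) (gen b ^ g^-1)
  (has_axis_flat_r g ab) (has_axis_flat g bv).
by exists (n + m)%N; [rewrite -add1n leq_add|apply: walk_cat wn wm].
Qed.

(** Flats through [g] correspond to edges of the defining graph, and edges with a common end give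
    flats with a common axis. A simple path in the defining graph therefore gives a walk of
    uniformly bounded length. *)
Lemma walk_common_point x y g : val x g -> val y g ->
  exists2 m, (m <= #|V|.+1)%N & walk flat_adj x y m.
Proof.
move=> /flat_vertexP[a [b [ab ->]]] /flat_vertexP[c [d [cd ->]]].
have [p bp pc] := e_conn.2 b c.
case: (shortenP bp) pc => q bq uq _ qc.
have [m mq wm] := walk_flats_path g ab bq cd qc; exists m => //.
apply: leq_trans mq _; rewrite ltnS; apply: ltnW.
by rewrite -[(size q).+1]/(size (b :: q)) -(card_uniqP uq) max_card.
Qed.

Definition local_flat (g : G) (v : V) : flat_vertex := mk_flat g (neighbourP e_val v).

Lemma local_flat_mem g x : val (local_flat g x.1) g /\
  val (local_flat g x.1) (g * letter e x).
Proof.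
split; first exact: flat_mem.
apply/flatP; rewrite mulKg /letter.
have h := @edge_group_gen V e x.1 (neighbour e x.1).
case: x.2 => //; exact: is_subgroupV (edge_group_is_subgroup _ _ _) h.
Qed.

Lemma flat_adj_conn : connected_graph flat_adj.
Proof.
split; first by have [v] := V_inh; constructor; exact: (local_flat 1 v).
move=> x y; have [g gx] := flat_vertex_mem x; have [h hy] := flat_vertex_mem y.
suff [n [p px [pl _]]] : exists n, walk flat_adj x y n by exists p.
rewrite -(mulVKg g h) -(word_of_raagK (g^-1 * h)) in hy.
move: (word_of_raag (g^-1 * h)) hy => w hy.
elim: w x g gx hy => [|[v b] w ih] x g gx hy.
  rewrite raag_of_word_nil mulg1 in hy.
  by have [m _ wm] := walk_common_point gx hy; exists m.
rewrite raag_of_word_cons mulgA in hy.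
have [gl gl'] := local_flat_mem g (v, b).
have [n wn] := ih _ _ gl' hy.
have [m _ wm] := walk_common_point gx gl; exists (m + n)%N; exact: walk_cat wm wn.
Qed.

Local Notation d := (gdist flat_adj).

Lemma gdist_common_axis x y t : has_axis t (val x) -> has_axis t (val y) ->
  (d x y <= 1)%N.
Proof.
move=> tx ty; have [m m1 wm] := walk_common_axis tx ty.
exact: leq_trans (gdist_min flat_adj_conn wm) m1.
Qed.

Lemma gdist_common_point x y g : val x g -> val y g -> (d x y <= #|V|.+1)%N.
Proof.
move=> gx gy; have [m m1 wm] := walk_common_point gx gy.
exact: leq_trans (gdist_min flat_adj_conn wm) m1.
Qed.

Fixpoint flats_along (g : G) (w : word V) : seq flat_vertex :=
  if w is x :: w' then local_flat g x.1 :: flats_along (g * letter e x) w'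
  else [::].

Lemma flats_along_path g w x y : val x g -> val y (g * ev w) ->
  path (fun u v => d u v <= #|V|.+1)%N x (rcons (flats_along g w) y).
Proof.
elim: w x g => [|[v b] w ih] x g gx /=.
  by rewrite raag_of_word_nil mulg1 andbT => gy; apply: gdist_common_point gx gy.
rewrite raag_of_word_cons mulgA => hy.
have [gl gl'] := local_flat_mem g (v, b).
by rewrite (gdist_common_point gx gl) ih.
Qed.

Lemma flats_along_axis g w z : z \in flats_along g w ->
  exists2 y, y \in crossings e w & has_axis (y.1 ^ g^-1) (val z).
Proof.
elim: w g => [|x w ih] g //=; rewrite inE => /orP[/eqP ->|/ih[y yw zy]].
  exists (gen x.1, x.2); [exact: mem_head|exact: has_axis_flat (neighbourP e_val x.1)].
exists (y.1 ^ (letter e x)^-1, y.2); last by rewrite /= -conjgM -invgM.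
by rewrite inE; apply/orP; right; apply/mapP; exists y.
Qed.

Lemma winding_step t g w : winding (g * ev w) t <> winding g t ->
  exists2 y, y \in crossings e w & t = y.1 ^ g^-1.
Proof.
rewrite windingM => h; have /winding_crossing[b tb] : winding (ev w) (t ^ g) <> 0%R.
  by move=> h'; apply: h; rewrite h' addr0.
by exists (t ^ g, b); rewrite // conjgK.
Qed.

(** A word in the two generators of a flat, read from a point of it, crosses only the two axes of
    that flat. *)
Lemma winding_flat t C g h : left_cosets MSA C -> ~ has_axis t C -> C g -> C h ->
  winding h t = winding g t.
Proof.
move=> /left_cosetsP[k [a [b [ab ->]]]] tC gk; rewrite -(flat_shift gk) in tC *.
move=> /flatP/edge_groupP[w [wE wA]].
apply/eqP/negPn/negP => /eqP; rewrite -(mulVKg g h) -wE => /winding_step[y].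
move=> /crossings_commuting[x x' /wA xA /wA xA'|x /wA xA -> tE].
  exact: edge_letters_commute ab xA xA'.
apply: tC; rewrite tE; case: xA => ->; [exact: has_axis_flat|exact: has_axis_flat_r].
Qed.

(** The winding about [t] is constant on a flat not containing its axis.  Two
    adjacent flats lie in a common coset of a star subgroup, in which the
    winding only changes across a flat sharing an axis with both. *)
Lemma axis_separates t q x g h : path flat_adj x q -> val x g ->
  val (last x q) h -> winding g t <> winding h t ->
  exists2 u, u \in x :: q & exists2 u', has_axis t (val u') & (d u u' <= 1)%N.
Proof.
elim: q x g => [|y q ih] x g /=.
  move=> _ xg xh gh; exists x; first exact: mem_head.
  exists x; last by rewrite (gdistxx flat_adj_conn).
  apply: contrapT => tx; apply: gh.
  exact/esym/(winding_flat (asboolP _ (valP x))).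
move=> /andP[/andP[_ /asboolP[r [rx ry]]] yq] xg yh gh.
case: (pselect (exists2 u', has_axis t (val u') & (d x u' <= 1)%N)) => [hx|nx].
  by exists x => //; apply: mem_head.
have ntx : ~ has_axis t (val x).
  by move=> tx; apply: nx; exists x => //; rewrite (gdistxx flat_adj_conn).
have [k [a [b [ab xE rE]]]] := rx; have [l [c [c' [cc' yE rE']]]] := ry.
have ly : val y l by rewrite yE; apply: flat_mem.
have kx : val x k by rewrite xE; apply: flat_mem.
have kg : winding k t = winding g t.
  exact: (winding_flat (asboolP _ (valP x))).
have [lk|lk] := pselect (winding l t = winding k t).
  have [|u uq hu] := ih y l yq ly yh; first by rewrite lk kg.
  by exists u => //; rewrite inE uq orbT.
(* Here [k^-1 * l] centralizes [gen a], so a word in the star of [a] leads from [k] to [l], and one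
   of its letters [v] crosses [t]. If [v = a], then [t] is the axis [r] of [x], which is excluded;
   otherwise the flat spanned by [v] and [a] at that point has both axes [t] and [r]. *)
case: nx; have ac : a = c by apply: (@conj_gen_inj V e _ _ k^-1 l^-1); rewrite -rE.
have [|w [wE wA]] := @centralizer_gen V e (k^-1 * l) a.
  apply/commute_sym/commute_conjg.
  by rewrite conjgM -rE rE' conjgKV ac.
rewrite -(mulVKg k l) -wE in lk; have [[s' b'] /crossings_split] := winding_step lk.
move=> [w1 [v [w2 [wE2 /= ->]]]]; rewrite -conjgM -invgM => tE.
have va : commute (gen v) (gen a).
  by apply: (wA (v, b')); rewrite wE2 mem_cat mem_head orbT.
have rE2 : gen a ^ (k * ev w1)^-1 = r.
  rewrite invgM conjgM rE; congr (_ ^ _); apply/conjg_commute/commuteV/commute_word.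
  by move=> z zw; apply/commute_sym/wA; rewrite wE2 mem_cat zw.
case/(gen_commuteP e_sym): va => [va|ev_a].
  by case: ntx; rewrite va rE2 in tE; rewrite tE.
exists (mk_flat (k * ev w1) ev_a); first by rewrite tE; apply: has_axis_flat.
apply: (@gdist_common_axis _ _ r) => //.
by rewrite -rE2; apply: has_axis_flat_r.
Qed.

(** Consecutive flats along a reduced word share a point, which bounds the jumps. The radius 2 is
    one step from the path to a flat with axis [t], by [axis_separates], and one more to the flat of
    the chain having that axis. *)
Lemma flat_bottleneck : bottleneck flat_adj #|V|.+1 2.
Proof.
move=> x y; have [g gx] := flat_vertex_mem x; have [h hy] := flat_vertex_mem y.
have [w [wE _ wr]] := reduced_word e (word_of_raag (g^-1 * h)).
rewrite word_of_raagK in wE wr.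
exists (rcons (flats_along g w) y); split; last 1 first.
- move=> q xq qy z; rewrite mem_rcons inE => /orP[/eqP ->|/flats_along_axis[c cw zc]].
    exists y; first by rewrite -qy mem_last.
    by rewrite (gdistxx flat_adj_conn).
  have hq : val (last x q) h by rewrite qy.
  have [|u uq [u' u'c uu']] := axis_separates (t := c.1 ^ g^-1) xq gx hq.
  (* The crossing belongs to a reduced word, so the windings of [g] and [h] about its translate
     differ. *)
  + rewrite -[in winding h _](mulVKg g h) windingM conjgKV => E.
    by apply: (wr _ cw); apply: (addrI (winding g (c.1 ^ g^-1))); rewrite addr0 -E.
  exists u => //; apply: leq_trans (gdist_tri flat_adj_conn u' _ _) _.
  by apply: leq_add uu' _; apply: gdist_common_axis u'c zc.
- by apply: flats_along_path; rewrite // wE mulVKg.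
- by rewrite last_rcons.
Qed.

End Flats.

Theorem corollary1p3 (R : realType) (V : finType) (e : rel V)
    (e_sym : symmetric e) (e_irr : irreflexive e)
    (e_conn : connected_graph e) (e_tri : triangle_free e)
    (e_val : forall v : V, 2 <= valence e v) :
  let K := coset_intersection_complex (@maximal_standard_abelian V e) in
  gromov_hyperbolic (@length_dist R _ K) /\
  quasi_isometric_to_tree (@length_dist R _ K).
Proof.
move=> K.
have sym := @flat_adj_sym V e; have conn := flat_adj_conn e_sym e_conn e_tri e_val.
have [[o] _] := conn.
have cl := bottleneck_bounded_clusters (o := o) sym conn
  (flat_bottleneck e_sym e_conn e_tri e_val).
have vert := flat_vert e_sym e_conn e_tri e_val.
have surj := flat_surj e_sym e_conn e_tri e_val.
have adjP := flat_adjP e_sym e_conn e_tri e_val.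
have glue := coset_glue e_sym e_conn e_tri e_val.
split.
  exact: (bounded_clusters_hyperbolic R val_inj vert surj adjP glue sym conn cl).
exact: (bounded_clusters_quasi_tree R val_inj vert surj adjP glue sym conn cl).
Qed.
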